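(* Let $G$ be a torsion-free word hyperbolic group in which each proper quasiconvex subgroup is engulfed. Then $G$ is GFERF.
   Context: Let $G$ be a word (Gromov) hyperbolic group with a finite symmetrized generating set $\mathcal{A}$ and Cayley graph $\Gamma(G,\mathcal{A})$. A subset $Q \subseteq G$ is quasiconvex if there exists $\eta \ge 0$ such that for any $u,v \in Q$, every geodesic segment in $\Gamma(G,\mathcal{A})$ connecting $u$ and $v$ lies in the closed $\eta$-neighborhood of $Q$; for hyperbolic groups this does not depend on the choice of the finite generating set. A subgroup $H \le G$ is engulfed if it is contained in a proper finite index subgroup of $G$. The profinite topology on $G$ has as basic open sets the cosets of normal finite index subgroups; a subgroup is closed in it if and only if it is an intersection of finite index subgroups of $G$. A hyperbolic group is GFERF if each of its quasiconvex subgroups is closed in the profinite topology. *)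

(* Defs.v *)
From HB Require Import structures.
From mathcomp Require Import all_boot all_order all_algebra.
From mathcomp Require Import all_classical topology.

Set Implicit Arguments.
Unset Strict Implicit.
Unset Printing Implicit Defensive.

Import Order.TTheory GRing.Theory Num.Theory.

Local Open Scope classical_set_scope.
Local Open Scope group_scope.

(* Infinite groups are MathComp [groupType]s (written multiplicatively);
   subsets and subgroups are classical sets. *)

Section CayleyGraph.
Context {G : groupType}.
Implicit Types (A Q : set G) (g h u v : G).

Definition is_word A (s : seq G) g : Prop :=
  (forall a, a \in s -> A a) /\ \prod_(a <- s) a = g.

(* Generation as a monoid, which is generation as a group when [A] is
   symmetrized. *)
Definition generates A : Prop := forall g, exists s, is_word A s g.

Definition symmetrized A : Prop := forall a, A a -> A a^-1.

Definition finite_symmetrized_generating_set A : Prop :=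
  [/\ finite_set A, symmetrized A & generates A].

(* The least length of a word representing [g] (the value 0 is used when there
   is none, which does not occur if [A] generates). *)
Definition word_length A g : nat :=
  xget 0%N [set n | (exists2 s, is_word A s g & size s = n) /\
                    (forall s, is_word A s g -> (n <= size s)%N)].

Definition word_dist A g h : nat := word_length A (g^-1 * h).

Definition cayley_adj A : rel G := [rel g h | (g^-1 * h) \in A].

(* [u :: p] is the list of vertices of a geodesic segment from [u] to [v]: an
   edge path whose length is the distance between its endpoints.  A geodesic of
   the metric graph with endpoints in [G] is always such an edge path. *)
Definition is_geodesic A u (p : seq G) v : Prop :=
  [/\ path (cayley_adj A) u p, last u p = v & size p = word_dist A u v].

(* Distances between vertices are integers, so a natural [eta] suffices.  Every
   point of the segment is within 1/2 of one of its vertices, so testing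
   vertices only does not change the notion. *)
Definition quasiconvex A Q : Prop :=
  exists eta : nat, forall u v (p : seq G), Q u -> Q v -> is_geodesic A u p v ->
    forall x, x \in u :: p -> exists2 q, Q q & (word_dist A x q <= eta)%N.

Local Open Scope ring_scope.

(* The Gromov product (x|y)_w, a half-integer for the word metric. *)
Definition gromov_product A (x y w : G) : rat :=
  ((word_dist A x w)%:R + (word_dist A y w)%:R - (word_dist A x y)%:R) / 2.

Definition gromov_hyperbolic A : Prop :=
  exists2 delta : rat, 0 <= delta &
    forall x y z w : G,
      Num.min (gromov_product A x z w) (gromov_product A z y w) - delta
        <= gromov_product A x y w.

End CayleyGraph.

Section Subgroups.
Context {G : groupType}.
Implicit Types (H K N : set G).

Definition is_subgroup H : Prop := group_closed (mem H).

Definition lcoset g H : set G := [set g * x | x in H].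

Definition finite_index H : Prop := finite_set (range (lcoset^~ H)).

Definition is_normal N : Prop := forall g x, N x -> N (x ^ g).

Definition engulfed H : Prop :=
  exists K, [/\ is_subgroup K, K <> setT, finite_index K & H `<=` K].

Definition profinite_basic (U : set G) : Prop :=
  exists N g, [/\ is_subgroup N, is_normal N, finite_index N & U = lcoset g N].

End Subgroups.

Definition torsion_free (G : groupType) : Prop :=
  forall (g : G) (n : nat), (0 < n)%N -> g ^+ n = 1 -> g = 1.

Section ProfiniteTopology.
Variable G : groupType.

Lemma is_subgroupP (H : set G) :
  is_subgroup H <-> H 1 /\ (forall x y, H x -> H y -> H (x / y)).
Proof.
split=> -[H1 HD]; split.
- exact: set_mem H1.
- by move=> x y Hx Hy; apply: set_mem; apply: HD; apply: mem_set.
- exact: mem_set H1.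
- by move=> x y /set_mem Hx /set_mem Hy; apply/mem_set/HD.
Qed.

Lemma lcoset_eqP (H : set G) (g h : G) : is_subgroup H ->
  lcoset g H h <-> lcoset g H = lcoset h H.
Proof.
move=> /is_subgroupP[H1 HD].
have HV x : H x -> H x^-1 by move=> Hx; rewrite -[_^-1]mul1g; apply: HD.
have HM x y : H x -> H y -> H (x * y).
  by move=> Hx Hy; rewrite -[y]invgK; apply: HD => //; apply: HV.
split=> [[x Hx <-]|->]; last by exists 1; rewrite ?mulg1.
apply/seteqP; split=> _ [y Hy <-].
  by exists (x^-1 * y); [apply: HM => //; apply: HV | rewrite mulgA mulgK].
by exists (x * y); [apply: HM | rewrite mulgA].
Qed.

Lemma finite_indexI (N M : set G) : is_subgroup N -> is_subgroup M ->
  finite_index N -> finite_index M -> finite_index (N `&` M).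
Proof.
move=> sN sM fN fM.
have lcosetI g : lcoset g (N `&` M) = lcoset g N `&` lcoset g M.
  apply/seteqP; split=> [_ [x [Nx Mx] <-]|_ [[x Nx <-] [y My]]].
    by split; exists x.
  by move/mulgI=> yx; exists x => //; split=> //; rewrite -yx.
apply: (@sub_finite_set _ _
  [set X `&` Y | X in range (lcoset^~ N) & Y in range (lcoset^~ M)]).
  move=> _ [g _ <-]; exists (lcoset g N); first by exists g.
  by exists (lcoset g M); [exists g | rewrite lcosetI].
exact: finite_image2.
Qed.

Lemma profinite_cover : \bigcup_(U in @profinite_basic G) id U = setT.
Proof.
apply/seteqP; split=> // g _; exists setT => //.
exists setT, 1; split=> //; first exact/is_subgroupP.
- apply: (@sub_finite_set _ _ [set setT]); last exact: finite_set1.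
  move=> _ [h _ <-]; apply/seteqP; split=> // k _.
  by exists (h^-1 * k); rewrite // mulVKg.
- by apply/seteqP; split=> // h _; exists h; rewrite // mul1g.
Qed.

Lemma profinite_join (U V : set G) (t : G) :
  profinite_basic U -> profinite_basic V -> id U t -> id V t ->
  exists W, [/\ profinite_basic W, id W t & id W `<=` id U `&` id V].
Proof.
move=> [N [g [sN nN fN ->]]] [M [h [sM nM fM ->]]] /=.
move=> /(lcoset_eqP g t sN) -> /(lcoset_eqP h t sM) ->.
move: (sN) (sM) => /is_subgroupP[N1 ND] /is_subgroupP[M1 MD].
exists (lcoset t (N `&` M)); split.
- exists (N `&` M), t; split=> //.
  + by apply/is_subgroupP; split=> // x y [Nx Mx] [Ny My]; split; auto.
  + by move=> k x [Nx Mx]; split; auto.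
  + exact: finite_indexI.
- by exists 1; rewrite ?mulg1.
- by move=> _ [x [Nx Mx] <-]; split; exists x.
Qed.

End ProfiniteTopology.

(* A copy of [G] carrying the profinite topology. *)
Definition profinite (G : groupType) : Type := G.

HB.instance Definition _ (G : groupType) := Choice.on (profinite G).
HB.instance Definition _ (G : groupType) :=
  @isBaseTopological.Build (profinite G) (set G) (@profinite_basic G) id
    (@profinite_cover G) (@profinite_join G).

Definition profinitely_closed (G : groupType) (H : set G) : Prop :=
  closed (H : set (profinite G)).

Definition GFERF (G : groupType) (A : set G) : Prop :=
  forall H : set G, is_subgroup H -> quasiconvex A H -> profinitely_closed H.

(* Main.v *)
Require Import Defs.
From mathcomp Require Import all_boot all_order all_algebra.
From mathcomp Require Import all_classical topology.
From mathcomp Require Import zify lra.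

(** Write K for the profinite closure of a quasiconvex subgroup H, that is, for the
intersection of the finite index subgroups that contain H; H is closed as soon
as K is contained in H.

The engulfing hypothesis is used through one construction.  Let M be
quasiconvex and nontrivial, let K be its closure, and suppose that finitely
many cosets of M do not cover K.  Then [free_over_exists] yields, for given
elements a_0, ..., a_n of G, elements s_j of K a_j K that are free over M: the
subgroup generated by M and the s_j is the free product of M and of the free
group on the s_j, and every normal form traces a broken geodesic with long
edges and small Gromov products at the corners.  Such a broken geodesic is
close to a geodesic, so M together with any of the s_j generates a quasiconvex
subgroup ([free_join_near_geodesics]), which is proper if one s_j is left out
([free_join_proper]).  Let a_0, ..., a_(n-1) generate G and leave out s_n.  A
finite index subgroup P that engulfs the result contains M, hence K, hence the
a_j, so that P = G, a contradiction.  So a nontrivial quasiconvex subgroup has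
finite index in its closure ([closure_covered]).

To pass from finite index to equality, suppose that k is in K but not in H
([pclosure_nontrivial]).  Now K is quasiconvex too, and if H has infinite index
in G there is s free over K.  The subgroup M generated by H and s is
quasiconvex, its closure contains k and s, and no positive power of k s lies in
M, by uniqueness of normal forms over K.  So M has infinite index in its
closure, against the previous paragraph.  If H is trivial ([pclosure1]), an
element k different from 1 is outside the cyclic subgroup generated by a high
power of a loxodromic element; this subgroup is closed by the previous case.

The elements s_j have the form p t_j p^-1.  Here p is in K, is a shortest
element of its coset M p, and is long; since G is torsion-free this forces
p^-1 h p to be long for every h in M other than 1 ([shortest_conj]).  The t_j
are built from a loxodromic f in M and its conjugate g = p0^-1 f p0, for another
such p0, whose axis diverges from that of f ([independent_conj]): t_j starts
with f ^ i g ^ n for an i of its own and ends with the inverse of such a word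
([free_family]).

All the geometry is done with the length function len and the doubled Gromov
products len x + len y - len (x^-1 y), which are natural numbers; the estimates
are then linear arithmetic. *)

Set Implicit Arguments.
Unset Strict Implicit.
Unset Printing Implicit Defensive.

Import Order.TTheory GRing.Theory Num.Theory.

Local Open Scope classical_set_scope.
Local Open Scope group_scope.

(** * Group identities *)

(** The group axioms oriented so as to bring a product of letters and inverses of
letters to its reduced form, associated to the left.  Each rule has a structure
of its own, because the operations of a [groupType] can be elaborated along
several inheritance paths. *)
Lemma gcancel :
  (((forall (G : semigroupType) (x y z : G), x * (y * z) = x * y * z)%g *
    (forall (G : starMonoidType) (x y : G), (x * y)^-1 = y^-1 * x^-1)%g *
    (forall (G : starMonoidType) (x : G), x^-1^-1 = x)%g *
    (forall G : starMonoidType, 1^-1 = 1 :> G)%g) *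
   ((forall (G : groupType) (x y : G), y * x * x^-1 = y)%g *
    (forall (G : groupType) (x y : G), y * x^-1 * x = y)%g *
    (forall (G : groupType) (x : G), x^-1 * x = 1)%g *
    (forall (G : groupType) (x : G), x * x^-1 = 1)%g *
    (forall (G : umagmaType) (x : G), 1 * x = x)%g *
    (forall (G : umagmaType) (x : G), x * 1 = x)%g))%type.
Proof.
by do !split=> *; rewrite ?(mulgA, invgM, invgK, invg1, mulgK, mulgVK,
  mulVg, mulgV, mul1g, mulg1).
Qed.

Section GroupIdentities.
Variable G : groupType.
Implicit Types (x y z : G) (s t : seq G).

Lemma gexpS x n : x ^+ n.+1 = x * x ^+ n.
Proof. exact: expgS. Qed.

Lemma gprod0 : \prod_(y <- [::] : seq G) y = 1.
Proof. exact: big_nil. Qed.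

Lemma gprod1 x : \prod_(y <- [:: x]) y = x.
Proof. exact: big_seq1. Qed.

Lemma gprod_cons x s : \prod_(y <- x :: s) y = x * \prod_(y <- s) y.
Proof. exact: big_cons. Qed.

Lemma gprod_cat s t :
  \prod_(y <- s ++ t) y = \prod_(y <- s) y * \prod_(y <- t) y.
Proof. exact: big_cat. Qed.

End GroupIdentities.

(** Products elaborated along different inheritance paths are different atoms for
[lia]; they are all brought to one path first. *)
Ltac group_atoms :=
  repeat match goal with
  | |- context [@monoid.mul ?M] =>
    lazymatch M with
    | monoid_Group__to__monoid_Magma _ => fail
    | _ => match goal with G : groupType |- _ =>
        progress change (@monoid.mul M)
          with (@monoid.mul (monoid_Group__to__monoid_Magma G)) end
    end
  | |- context [@natexp ?M] =>
    lazymatch M with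
    | monoid_Group__to__monoid_BaseUMagma _ => fail
    | _ => match goal with G : groupType |- _ =>
        progress change (@natexp M)
          with (@natexp (monoid_Group__to__monoid_BaseUMagma G)) end
    end
  | |- context [@monoid.inv ?M] =>
    lazymatch M with
    | monoid_Group__to__monoid_BaseGroup _ => fail
    | _ => match goal with G : groupType |- _ =>
        progress change (@monoid.inv M)
          with (@monoid.inv (monoid_Group__to__monoid_BaseGroup G)) end
    end
  | |- context [@monoid.one ?M] =>
    lazymatch M with
    | monoid_Group__to__monoid_BaseUMagma _ => fail
    | _ => match goal with G : groupType |- _ =>
        progress change (@monoid.one M)
          with (@monoid.one (monoid_Group__to__monoid_BaseUMagma G)) end
    end
  end.

Ltac glia :=
  repeat match goal with
  | H : is_true (leq _ _) |- _ => revert H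
  | H : is_true (negb (leq _ _)) |- _ => revert H
  | H : @eq nat _ _ |- _ => revert H
  end; group_atoms; lia.

(** * Length functions of hyperbolic groups *)

Section HyperbolicLength.
Variables (G : groupType) (len : G -> nat) (D : nat).

(** The word length of a hyperbolic group, abstracted from the generating set.
[len_four] is the four-point condition with one of the points at 1; for D one
can take any natural number above twice the hyperbolicity constant. *)
Record hyperbolic_length : Prop :=
  HyperbolicLength {
    len1 : len 1 = 0%N;
    lenV : forall x, len x^-1 = len x;
    lenM : forall x y, (len (x * y) <= len x + len y)%N;
    len_ball : forall n, exists F : seq G, forall x, (len x <= n)%N -> x \in F;
    len_split : forall x n, (n <= len x)%N ->
      exists2 y, len y = n & len (y^-1 * x) = (len x - n)%N;
    len_four : forall x y z,
      (len (x^-1 * y) + len z <=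
         maxn (len (z^-1 * x) + len y) (len (z^-1 * y) + len x) + D)%N }.

End HyperbolicLength.

Section Divergence.
Variables (G : groupType) (len : G -> nat) (D : nat).
Hypothesis hl : hyperbolic_length len D.
Implicit Types (x y z u v b h p q : G) (c e n : nat).

(** Twice the Gromov product of x and y at 1 is at most c: geodesics from 1 to x and
to y separate within about c / 2 of 1. *)
Definition diverge c x y : bool := (len x + len y <= len (x^-1 * y) + c)%N.

Lemma len_distC x y : len (x^-1 * y) = len (y^-1 * x).
Proof. by rewrite -(lenV hl) !gcancel. Qed.

Lemma len_dist_trans z x y :
  (len (x^-1 * y) <= len (x^-1 * z) + len (z^-1 * y))%N.
Proof. by have := lenM hl (x^-1 * z) (z^-1 * y); rewrite !gcancel. Qed.

Lemma len_mul_ge x y : (len x <= len (x * y) + len y)%N.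
Proof. by have := lenM hl (x * y) y^-1; rewrite mulgK (lenV hl). Qed.

Lemma len_mul_ger x y : (len y <= len (x * y) + len x)%N.
Proof. by have := lenM hl x^-1 (x * y); rewrite mulKg (lenV hl) addnC. Qed.

Lemma lenX x n : (len (x ^+ n) <= n * len x)%N.
Proof.
elim: n => [|n IHn]; first by rewrite (len1 hl).
by rewrite gexpS mulSn; have := lenM hl x (x ^+ n); glia.
Qed.

Lemma len_conj p x : (len (p^-1 * x * p) <= len x + 2 * len p)%N.
Proof.
have := lenM hl (p^-1 * x) p; have := lenM hl p^-1 x; rewrite (lenV hl); glia.
Qed.

Lemma diverge_sym c x y : diverge c x y -> diverge c y x.
Proof. by rewrite /diverge (len_distC y x) addnC. Qed.

Lemma diverge_weak c e x y : (c <= e)%N -> diverge c x y -> diverge e x y.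
Proof. by rewrite /diverge; glia. Qed.

(** A tree has no branch that follows two diverging branches at once; hyperbolicity
costs D. *)
Lemma diverge_or c u x y : diverge c x y ->
  diverge (c + D) u x \/ diverge (c + D) u y.
Proof.
rewrite /diverge => H; have := len_four hl x y u.
case: (leqP (len (u^-1 * x) + len y) (len (u^-1 * y) + len x)) => _ ?;
  [right|left]; glia.
Qed.

(** If x and y have a long common initial part, then what diverges early from x
also diverges from y. *)
Lemma diverge_near e u x y : diverge e u x ->
  (len x + e + D + len (x^-1 * y) < 2 * len x + len y)%N -> 
  diverge (e + D) u y.
Proof.
rewrite /diverge => H H'; have := len_four hl u x y.
rewrite (len_distC y x) (len_distC y u).
case: (leqP (len (u^-1 * y) + len x) (len (x^-1 * y) + len u)) => _ ?; glia.
Qed.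

(** The case of [diverge_near] in which x is, up to c, an initial part of x y. *)
Lemma diverge_ext e c u x y : diverge e u x -> diverge c x^-1 y ->
  (e + c + D < 2 * len x)%N -> diverge (e + D) u (x * y).
Proof.
move=> H; rewrite /diverge invgK (lenV hl) => Hxy Hx.
by apply: diverge_near H _; rewrite !gcancel; glia.
Qed.

Lemma diverge_shiftl c b x y :
  diverge c x (b^-1 * y) -> diverge (c + 2 * len b) (b * x) y.
Proof.
rewrite /diverge !gcancel; have := lenM hl b x.
have := lenM hl b (b^-1 * y); rewrite mulVKg; glia.
Qed.

Lemma diverge_mulr c b x y : diverge c x y -> diverge (c + 2 * len b) (x * b) y.
Proof.
rewrite /diverge !gcancel => H; have := lenM hl x b.
have := len_mul_ger b^-1 (x^-1 * y); rewrite (lenV hl) !gcancel; glia.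
Qed.

Lemma diverge_lenM c x y : diverge c x^-1 y -> (len x + len y <= len (x * y) + c)%N.
Proof. by rewrite /diverge invgK (lenV hl). Qed.

(** Consecutive letters of a word that traces a broken geodesic: the edge is longer
than what the corner can cancel. *)
Definition chain_step c : rel G := fun a b => (c + 2 * D < len a)%N && diverge c a^-1 b.

(** The local condition propagates: each edge is longer than the backtracking at
its two ends, so that the cancellation at the first corner does not depend on
what follows. *)
Lemma chain_head c a w : path (chain_step c) a w ->
  (len a + len (\prod_(b <- w) b) <= len (a * \prod_(b <- w) b) + c + D)%N.
Proof.
elim: w a => [|b w IHw] a /=; first by rewrite gprod0 (len1 hl) !gcancel; glia.
case/andP=> /andP[La ab] /[dup] bw /IHw IH; rewrite gprod_cons.
have [w0|w_n0] := eqVneq w [::].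
  by move/diverge_lenM: ab; rewrite w0 gprod0 !gcancel; glia.
have Lb : (c + 2 * D < len b)%N by case: (w) w_n0 bw => //= ? ? _ /andP[/andP[]].
suff /diverge_lenM : diverge (c + D) a^-1 (b * \prod_(b <- w) b) by glia.
by apply: diverge_ext ab (_ : diverge (c + D) _ _) _;
  rewrite /diverge ?invgK ?(lenV hl); glia.
Qed.

(** The mirror image of [chain_head]. *)
Lemma chain_last c a w b : path (chain_step c) a (rcons w b) ->
  (len (a * \prod_(x <- w) x) + len b <= len (a * \prod_(x <- w) x * b) + c + D)%N.
Proof.
elim/last_ind: w b => [|w d IHw] b /=.
  by rewrite gprod0 !gcancel andbT => /andP[_ /diverge_lenM]; glia.
rewrite rcons_path last_rcons => /andP[aw /andP[Ld /diverge_sym db]].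
have := IHw d aw; rewrite -cats1 gprod_cat gprod1 !gcancel.
set P := _ * \prod_(_ <- _) _; clearbody P => Pd.
have PdV := lenV hl (P * d); have PdbV := lenV hl (P * d * b).
have : diverge (c + D) b (d^-1 * P^-1).
  apply: (diverge_ext (c := c + D)) db _ _; last by rewrite (lenV hl); glia.
  by rewrite /diverge !gcancel !(lenV hl); move: PdV; rewrite !gcancel; glia.
by rewrite /diverge !gcancel; move: PdV PdbV; rewrite !gcancel; glia.
Qed.

(** Every vertex of the broken geodesic is near a geodesic between its ends. *)
Lemma chain_split c a w1 w2 : path (chain_step c) a (w1 ++ w2) ->
  (len (a * \prod_(x <- w1) x) + len (\prod_(x <- w2) x) <=
     len (a * \prod_(x <- w1 ++ w2) x) + c + 2 * D)%N.
Proof.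
rewrite gprod_cat !gcancel.
elim/last_ind: w1 => [|w1 b _]; first by rewrite cat0s => /chain_head; rewrite gprod0 !gcancel; glia.
have [->|w2_n0] := eqVneq w2 [::].
  by rewrite gprod0 !gcancel (len1 hl); glia.
rewrite -cats1 -catA cat_path /= => /and3P[aw1 w1b bw2].
have Wb : diverge (c + D) (\prod_(x <- w2) x) b^-1.
  have := chain_head bw2; have := lenV hl (b * \prod_(x <- w2) x).
  by rewrite /diverge !gcancel (lenV hl b); glia.
have Lb : (c + 2 * D < len b)%N by case: (w2) w2_n0 bw2 => //= ? ? _ /andP[/andP[]].
have /chain_last : path (chain_step c) a (rcons w1 b) by rewrite rcons_path aw1.
rewrite gprod_cat gprod1 !gcancel; move: Wb; set P := _ * \prod_(_ <- w1) _.
set W := \prod_(_ <- w2) _; clearbody P W => Wb Pb.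
have PbV := lenV hl (P * b); have PbWV := lenV hl (P * b * W).
have : diverge (c + D + D) W (b^-1 * P^-1).
  apply: (diverge_ext (c := c + D)) Wb _ _; last by rewrite (lenV hl); glia.
  by rewrite /diverge !gcancel !(lenV hl); move: PbV; rewrite !gcancel; glia.
by rewrite /diverge !gcancel; move: PbV PbWV; rewrite !gcancel; glia.
Qed.
End Divergence.

(** * Subgroups, cosets and powers *)

Section Subgroup.
Variables (G : groupType) (M : set G).
Hypothesis sM : is_subgroup M.

Lemma sub1 : M 1. Proof. by case/is_subgroupP: sM. Qed.

Lemma subV x : M x -> M x^-1.
Proof. by case/is_subgroupP: sM => M1 MD Mx; rewrite -[_^-1]mul1g; apply: MD. Qed.

Lemma subM x y : M x -> M y -> M (x * y).
Proof.
case/is_subgroupP: sM => M1 MD Mx My; rewrite -[y]invgK.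
by apply: MD => //; apply: subV.
Qed.

Lemma subX x n : M x -> M (x ^+ n).
Proof.
by move=> Mx; elim: n => [|n IHn]; [exact: sub1 | rewrite gexpS; apply: subM].
Qed.

End Subgroup.

(** K is a union of finitely many right cosets of M; for K containing M this says
that M has finite index in K. *)
Definition covered (G : groupType) (M K : set G) : Prop :=
  exists F : seq G, forall k, K k -> exists2 f, f \in F & M (k * f^-1).

Lemma finite_repetition (T : eqType) (F : seq T) (fn : nat -> T) :
  (forall i, (i <= size F)%N -> fn i \in F) ->
  exists i j, [/\ (i < j)%N, (j <= size F)%N & fn i = fn j].
Proof.
move=> FF; set s := map fn (iota 0 (size F).+1).
have : ~~ uniq s.
  apply/negP => /uniq_leq_size/(_ (_ : {subset s <= F})).
  rewrite size_map size_iota ltnn => H; suff : false by []; apply: H.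
  by move=> _ /mapP[i + ->]; rewrite mem_iota => ?; apply: FF; lia.
case/(uniqPn (fn 0)) => i [j []]; rewrite size_map size_iota => ij js.
rewrite !(nth_map 0%N) ?size_iota ?nth_iota; try lia; move=> e.
by exists i, j.
Qed.

Lemma expg_inj_torsion_free (G : groupType) (g : G) i j :
  torsion_free G -> g <> 1 -> g ^+ i = g ^+ j -> i = j.
Proof.
move=> tf g1; wlog ij : i j / (i <= j)%N.
  by move=> H e; case: (leqP i j) => [/H->//|/ltnW/H->].
move=> e; apply/eqP; rewrite eqn_leq ij /=; rewrite leqNgt; apply/negP => lt_ij.
apply: g1; apply: (tf _ (j - i)%N); first by rewrite subn_gt0.
by rewrite expgnFr // -e mulgV.
Qed.

Lemma expgVn_mulV (G : groupType) (g : G) n : g^-1 ^+ n = (g ^+ n)^-1.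
Proof. exact: expVgn. Qed.

Lemma conj_exp (G : groupType) (p h : G) n :
  (p^-1 * h * p) ^+ n = p^-1 * h ^+ n * p.
Proof.
elim: n => [|n IHn]; first by rewrite !expg0 !gcancel.
by rewrite !gexpS IHn !gcancel.
Qed.

(** * Quasiconvex subgroups *)

Section Quasiconvex.
Variables (G : groupType) (len : G -> nat) (D : nat).
Hypothesis hl : hyperbolic_length len D.
Implicit Types (x y z u v b h p q f g : G) (c e n i j : nat) (M K : set G).
Local Notation diverge := (diverge len).
Local Notation chain_step := (chain_step len D).

(** x is on a geodesic from u to v, up to the defect e. *)
Definition between e u v x : bool :=
  (len (u^-1 * x) + len (x^-1 * v) <= len (u^-1 * v) + e)%N.

(** A point near a geodesic between the ends of a path is near one of its edges, if
the vertices of the path are near that geodesic: the edge is the first one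
whose endpoint is not before x. *)
Lemma between_chain c e (X : nat -> G) n x : (0 < n)%N -> X 0%N = 1 ->
  (forall i, (i <= n)%N ->
     (len (X i) + len ((X i)^-1 * X n) <= len (X n) + c)%N) ->
  between e 1 (X n) x ->
  exists2 i, (i < n)%N & between (c + 2 * e + 2 * D) (X i) (X i.+1) x.
Proof.
move=> n0 X0 Xc; rewrite /between !gcancel => bx.
pose T i := (len x + len (x^-1 * X i) <= len (X i) + (e + D))%N.
have T_or m : T m \/
    (len ((X m)^-1 * x) + len (x^-1 * X n) <= len ((X m)^-1 * X n) + (e + D))%N.
  have : diverge e x^-1 (x^-1 * X n) by rewrite /diverge !gcancel (lenV hl); glia.
  case/(diverge_or hl (x^-1 * X m)); rewrite /diverge !gcancel.
    by rewrite !(lenV hl) => H; left; rewrite /T; glia.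
  by move=> H; right; rewrite (len_distC hl _ x); glia.
have Tn : T n by rewrite /T; lia.
have [T0|nT0] := boolP (T 0%N).
  exists 0%N => //; move: T0; rewrite /T X0 !gcancel (lenV hl) (len1 hl) => T0.
  by have := lenM hl x^-1 (X 1%N); rewrite (lenV hl); glia.
(* The first vertex that x does not come after; it is not the vertex 0. *)
have [i iP imin] := ex_minnP (ex_intro _ n Tn).
case: i iP imin => [|i] Ti imin; first by rewrite Ti in nT0.
have lt_in : (i < n)%N by exact: imin.
exists i => //; case: (T_or i) => [/imin|]; first by rewrite ltnn.
move=> H; have := Xc i.+1 lt_in; move: Ti; rewrite /T => Ti H'.
have := lenM hl x (x^-1 * X n); rewrite !gcancel => H1.
have := len_dist_trans hl (X i.+1) (X i) (X n) => H2; glia.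
Qed.

(** Quasiconvexity of a subgroup M.  By translation one end of the geodesic may be
1, and a point lies on some geodesic from 1 to h as soon as the distances
add up. *)
Definition near_geodesics e M : Prop := forall h x, M h -> between 0 1 h x ->
  exists2 m, M m & (len (x^-1 * m) <= e)%N.

Lemma near_quasigeodesic eta e M h x : near_geodesics eta M -> M h ->
  between e 1 h x -> exists2 m, M m & (len (x^-1 * m) <= eta + e + D)%N.
Proof.
move=> qM Mh; rewrite /between !gcancel => bx.
have [xh|hx] := leqP (len x) (len h); last by exists h => //; lia.
have [y yx yh] := len_split hl xh.
have [|m Mm ym] := qM h y Mh; first by rewrite /between !gcancel; glia.
exists m => //; have := len_dist_trans hl y x m.
have := len_four hl x y h; rewrite (len_distC hl h x) (len_distC hl h y).
case: (leqP (len (x^-1 * h) + len y)%N (len (y^-1 * h) + len x)%N) => _; glia.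
Qed.

Definition shortest M p : Prop := forall m, M m -> (len p <= len (m * p))%N.

Lemma shortest_exists M g : is_subgroup M -> exists2 m, M m & shortest M (m * g).
Proof.
move=> sM; have [n] := ubnP (len g); elim: n g => // n IHn g lgn.
have [sg|] := pselect (shortest M g).
  by exists 1; [exact: sub1 | rewrite gcancel].
move=> /existsNP[m /not_implyP[Mm /negP]]; rewrite -ltnNge => lm.
have [|m' Mm'] := IHn (m * g); first by lia.
by exists (m' * m); [exact: subM | rewrite -!mulgA].
Qed.

(** If h and p had a long common initial part, its end would be near an element m of
M, and m^-1 p would be shorter than p. *)
Lemma shortest_diverge eta M p h : is_subgroup M -> near_geodesics eta M ->
  shortest M p -> M h -> diverge (2 * eta + 2 * D + 1) h p.
Proof.
move=> sM qM sp Mh; rewrite /diverge leqNgt; apply/negP => Hlt.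
pose t := (eta + D + 1)%N.
have tri := lenM hl h (h^-1 * p); have tri' := lenM hl h^-1 p.
have tri2 := len_mul_ger hl h^-1 p.
rewrite !gcancel ?(lenV hl) in tri tri' tri2.
have th : (t <= len h)%N by rewrite /t; glia.
have [y yt yh] := len_split hl th.
have [|m Mm ym] := qM h y Mh; first by rewrite /between !gcancel; glia.
have := sp _ (subV sM Mm); rewrite (len_distC hl).
have := len_dist_trans hl y p m; have := len_four hl y p h.
rewrite (len_distC hl p y) (len_distC hl h y).
case: (leqP (len (y^-1 * h) + len p)%N (len (h^-1 * p) + len y)%N) => _.
all: rewrite /t in th yt yh *; glia.
Qed.

Lemma far_shortest M K T : is_subgroup M -> is_subgroup K -> M `<=` K ->
  ~ covered M K -> exists p, [/\ K p, shortest M p & (T <= len p)%N].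
Proof.
move=> sM sK MK ncov; apply: contrapT => nex; apply: ncov.
have [F FP] := len_ball hl T; exists F => k Kk.
have [m Mm smk] := shortest_exists k sM; exists (m * k).
  apply: FP; rewrite leqNgt; apply/negP => lt; apply: nex.
  by exists (m * k); split=> //; [apply: (subM sK) => //; exact: MK | lia].
by rewrite !gcancel; exact: subV.
Qed.

Hypothesis tf : torsion_free G.

(** Balls are finite, and the powers of an element of infinite order are distinct. *)
Lemma unbounded_powers g T : g <> 1 ->
  exists2 n, (0 < n)%N & (T <= len (g ^+ n))%N.
Proof.
move=> g1; apply: contrapT => nex; have [F FP] := len_ball hl T.
have [|i [j [ij _]]] := @finite_repetition _ F (fun i => g ^+ i.+1).
  move=> i _; apply: FP; rewrite leqNgt; apply/negP => lt; apply: nex.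
  by exists i.+1 => //; lia.
by move/(expg_inj_torsion_free tf g1); lia.
Qed.

Lemma unbounded_powers_ball R (F : seq G) : exists N, forall h, h \in F -> h <> 1 ->
  exists n, (n <= N)%N /\ (R <= len (h ^+ n))%N.
Proof.
elim: F => [|g F [N IHF]]; first by exists 0%N.
have [->|/eqP g1] := eqVneq g 1.
  by exists N => h; rewrite inE => /orP[/eqP->//|/IHF].
have [n _ nR] := unbounded_powers R g1; exists (N + n)%N => h.
rewrite inE => /orP[/eqP-> _|/IHF H /H[k [kN kR]]].
  by exists n; split=> //; lia.
by exists k; split=> //; lia.
Qed.

Lemma len_conj_ge c p h : diverge c h p -> diverge c h^-1 p ->
  (c + D < len h)%N -> (2 * len p + len h <= len (p^-1 * h * p) + 2 * c + D)%N.
Proof.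
move=> hp hVp lh.
have := diverge_ext hl (diverge_sym hl hp) hVp; move/(_ ltac:(lia)).
have := diverge_lenM hl hVp; rewrite /diverge !gcancel; glia.
Qed.

(** For long h the path p^-1, h, p is a broken geodesic.  For the finitely many
short h there are long powers h^n, with n bounded by N say; then p^-1 h^n p has
length at least about 2 len p, and p^-1 h p at least 1 / N of it. *)
Lemma shortest_conj eta M L : is_subgroup M -> near_geodesics eta M ->
  exists T, forall p, shortest M p -> (T <= len p)%N ->
    forall h, M h -> h <> 1 -> (len h + L <= len (p^-1 * h * p))%N.
Proof.
move=> sM qM; pose c := (2 * eta + 2 * D + 1)%N; pose R := (c + D + 1)%N.
have [F FP] := len_ball hl R; have [N NP] := unbounded_powers_ball R F.
(* N bounds the exponents that make short elements of M long. *)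
exists (N * (R + L) + 2 * c + D + L)%N => p sp Tp h Mh h1.
have big m : M m -> (R <= len m)%N ->
    (2 * len p + len m <= len (p^-1 * m * p) + 2 * c + D)%N.
  move=> Mm Rm; apply: len_conj_ge; [| |rewrite /R in Rm; lia].
    exact: shortest_diverge Mm.
  by apply: shortest_diverge (subV sM Mm).
have [Rh|hR] := leqP R (len h); first by have := big h Mh Rh; lia.
have [n [nN Rn]] := NP h (FP _ (ltnW hR)) h1.
have := big _ (subX sM n Mh) Rn; rewrite -conj_exp => H.
rewrite leqNgt; apply/negP => lt.
have := lenX hl (p^-1 * h * p) n.
have : (n * len (p^-1 * h * p) <= N * (R + L))%N by apply: leq_mul => //; lia.
by move: (N * _)%N (n * _)%N Tp => ? ? ?; glia.
Qed.

(** * Loxodromic elements *)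

(** The powers of f and those of its inverse diverge, so that n -> f^n is a
quasigeodesic. *)
Definition loxodromic c f : Prop := forall n m, diverge c (f^-1 ^+ n) (f ^+ m).

Lemma loxodromicV c f : loxodromic c f -> loxodromic c f^-1.
Proof. by move=> lf n m; rewrite invgK; apply: (diverge_sym hl). Qed.

Lemma loxodromicX c f k : loxodromic c f -> loxodromic c (f ^+ k).
Proof. by move=> lf n m; rewrite -expgVn_mulV -!expgnA. Qed.

Lemma loxodromicD c f n m : loxodromic c f ->
  (len (f ^+ n) + len (f ^+ m) <= len (f ^+ (n + m)) + c)%N.
Proof.
by move=> /(_ n m); rewrite expgVn_mulV => /(diverge_lenM hl); rewrite expgnDr.
Qed.

Lemma gprod_nseq f n : \prod_(x <- nseq n f) x = f ^+ n.
Proof. by elim: n => [|n IHn]; rewrite ?gprod0 //= gprod_cons IHn gexpS. Qed.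

(** If the corner of the path f, f is small, then all the powers of f trace a broken
geodesic. *)
Lemma loxodromic_step c f : (c + 2 * D < len f)%N -> diverge c f^-1 f ->
  loxodromic (c + 2 * D) f.
Proof.
move=> lf ff [|n] m; first by rewrite /diverge (len1 hl) !gcancel; glia.
have pf k : path (chain_step c) f (nseq k f).
  by elim: k => //= k ->; rewrite /chain_step lf ff.
have := @chain_split _ _ _ hl c f (nseq n f) (nseq m f).
rewrite -nseqD => /(_ (pf _)); rewrite !gprod_nseq.
by rewrite /diverge expgVn_mulV !(lenV hl, gcancel) !gexpS expgnDr !gcancel; glia.
Qed.

(** Cut a long geodesic from 1 to h at a point q of M near its middle: a = q^-1 and
b = q^-1 h are long and diverge.  If neither is loxodromic, then each of them
starts as its own inverse does, so that a, a^-1 both diverge from b, b^-1, and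
the product a b is loxodromic. *)
Lemma loxodromic_exists eta M : is_subgroup M -> near_geodesics eta M ->
  (exists2 h, M h & h <> 1) -> exists f c, [/\ M f, f <> 1 & loxodromic c f].
Proof.
move=> sM qM [h0 Mh0 h01].
pose c := (2 * eta + 4 * D)%N; pose L := (2 * c + 4 * D + 1)%N.
have cand f : M f -> (L <= len f)%N -> diverge c f^-1 f ->
    exists f c, [/\ M f, f <> 1 & loxodromic c f].
  move=> Mf Lf ff; exists f, (c + 2 * D)%N; split=> //.
    by move=> f1; rewrite f1 (len1 hl) in Lf; rewrite /L in Lf; lia.
  by apply: loxodromic_step => //; rewrite /L in Lf; lia.
(* Any long element of M will do; a power of h0 is one. *)
have [n _] := unbounded_powers (2 * (L + eta)) h01.
move: (_ ^+ n) (subX sM n Mh0) => h Mh lh.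
have le_h : (L + eta <= len h)%N by lia.
have [x lx lxh] := len_split hl le_h.
have [|q Mq xq] := qM h x Mh; first by rewrite /between !gcancel; lia.
pose a := q^-1; pose b := q^-1 * h.
have Ma : M a by exact: subV. have Mb : M b by exact: subM.
have La : (L <= len a)%N.
  by rewrite /a (lenV hl); have := lenM hl q (q^-1 * x); 
     rewrite (len_distC hl q x) !gcancel; glia.
have Lb : (L <= len b)%N.
  by rewrite /b; have := len_dist_trans hl q x h; glia.
have ab : diverge (2 * eta) a b.
  rewrite /diverge /a /b !gcancel (lenV hl).
  have := len_dist_trans hl x q h; rewrite (len_distC hl q x).
  by have := lenM hl x (x^-1 * q); rewrite !gcancel; glia.
have [|aa] := boolP (diverge c a^-1 a); first exact: cand.
have [|bb] := boolP (diverge c b^-1 b); first exact: cand.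
have abV : diverge (2 * eta + D) a b^-1.
  apply: (diverge_near hl ab); rewrite (len_distC hl) (lenV hl).
  by move: bb; rewrite /diverge -ltnNge (lenV hl) /c; glia.
have aVb : diverge (2 * eta + D) a^-1 b.
  apply: (diverge_sym hl); apply: (diverge_near hl (diverge_sym hl ab)).
  by move: aa; rewrite /diverge -ltnNge (lenV hl) /c (len_distC hl); glia.
apply: (cand (a * b)); first exact: subM.
  by have := diverge_lenM hl aVb; rewrite /L /c in La Lb *; glia.
have H1 : diverge (2 * eta + D + D) b^-1 (a * b).
  apply: (diverge_ext hl (diverge_sym hl abV) aVb).
  by rewrite /L /c in La; lia.
have H2 : diverge (2 * eta + D + D + D) (a * b) (b^-1 * a^-1).
  have bVaV : diverge (2 * eta + D) b^-1^-1 a^-1 by rewrite invgK (diverge_sym hl).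
  apply: (diverge_ext hl (diverge_sym hl H1) bVaV).
  by rewrite (lenV hl); rewrite /L /c in Lb; lia.
by rewrite invgM; apply: (diverge_sym hl); apply: diverge_weak H2; rewrite /c; lia.
Qed.

End Quasiconvex.

(** * Independent loxodromic elements *)

Section Independent.
Variables (G : groupType) (len : G -> nat) (D : nat).
Hypothesis hl : hyperbolic_length len D.
Hypothesis tf : torsion_free G.
Implicit Types (x y z u v b h p q f g : G) (c e n i j : nat) (M K : set G).
Local Notation diverge := (diverge len).
Local Notation loxodromic := (loxodromic len).

Lemma expg_sub x i n : (i <= n)%N -> (x ^+ i)^-1 * x ^+ n = x ^+ (n - i).
Proof. by move=> le_in; rewrite -{1}(subnKC le_in) expgnDr mulKg. Qed.

(** If x^n and p^-1 y^m have arbitrarily long common initial parts, then each of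
many powers x^i is within a constant distance of some p^-1 y^j.  Balls are
finite, so the same element x^-i p^-1 y^j occurs for two values of i, and this
is a relation between x^r and a conjugate of a power of y. *)
Lemma fellow_travel_relation c p x y : loxodromic c x -> loxodromic c y ->
  (forall C, exists n m, ~ diverge C (x ^+ n) (p^-1 * y ^+ m)) ->
  exists r k z, [/\ (0 < r)%N, z \in [:: y; y^-1] & p^-1 * z ^+ k * p = x ^+ r].
Proof.
move=> lx ly far; pose E := (2 * len p + c + D)%N.
have [F FP] := len_ball hl (c + 2 * E + 2 * D + len y).
(* The common part must contain more powers of x than F has elements. *)
have [n [m /negP]] := far (2 * size F * len x + 2 * len p)%N.
rewrite /diverge -ltnNge => Cnm.
set X := x ^+ n in Cnm; set Y := p^-1 * y ^+ m in Cnm.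
have Xn : (len X <= n * len x)%N by exact: (lenX hl x n).
have XY := len_mul_ger hl X (X^-1 * Y); have YX := lenM hl X (X^-1 * Y).
have XY' := len_mul_ge hl X (X^-1 * Y).
rewrite mulVKg in XY YX XY'.
have Fn : (size F < n)%N.
  rewrite ltnNge; apply/negP => nF.
  have := leq_mul nF (leqnn (len x)); rewrite -mulnA in Cnm.
  by move: (_ * len x)%N (_ * len x)%N Xn Cnm => ? ? ? ? ?; glia.
have m0 : (0 < m)%N.
  case: m @Y Cnm XY YX XY' => [|//] Y Cnm XY YX XY'.
  have : (len Y <= len p)%N by rewrite /Y expg0 mulg1 (lenV hl).
  have := lenM hl Y^-1 X; have := len_mul_ge hl X^-1 Y; rewrite !(lenV hl); glia.
have near_i i : exists j, (i <= size F)%N -> (x ^+ i)^-1 * p^-1 * y ^+ j \in F.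
  have [iF|_] := leqP i (size F); last by exists 0%N.
  have in_ : (i <= n)%N by lia.
  have li := lenX hl x i.
  have li2 : (2 * len (x ^+ i) <= 2 * size F * len x)%N by nia.
  have := loxodromicD hl i (n - i) lx; rewrite subnKC // -/X => Xi.
  have bz : between len E 1 (y ^+ m) (p * x ^+ i).
    rewrite /between invg1 !mul1g.
    have := len_four hl (x ^+ i) Y X; rewrite (len_distC hl X (x ^+ i)).
    rewrite expg_sub //; have := lenM hl p (x ^+ i).
    have := lenM hl p^-1 (y ^+ m); rewrite (lenV hl) -/Y -/X.
    rewrite invgM -mulgA -/Y.
    case: (leqP (len (x ^+ (n - i)) + len Y) (len (X^-1 * Y) + len (x ^+ i)))%N => _;
      rewrite /E; glia.
  have [|j _ bj] := @between_chain _ _ _ hl c E (fun j => y ^+ j) m _ m0 (expg0 _) _ bz.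
    move=> j jm; rewrite expg_sub //.
    by have := loxodromicD hl j (m - j) ly; rewrite subnKC.
  exists j => _; apply: FP; move: bj; rewrite /between expg_sub // subSnn expg1.
  by rewrite (len_distC hl _ (p * _)) invgM; glia.
have [J JP] := choice near_i.
have [i [j [ij jF e]]] := finite_repetition JP.
have e2 : p^-1 * (y ^+ J j * (y ^+ J i)^-1) * p = x ^+ (j - i).
  have -> : y ^+ J j = p * x ^+ j * ((x ^+ i)^-1 * p^-1 * y ^+ J i).
    by rewrite e !gcancel.
  by rewrite expgnFr 1?ltnW // !gcancel.
exists (j - i)%N; case: (leqP (J i) (J j)) => Jij.
  by exists (J j - J i)%N, y; rewrite subn_gt0 inE eqxx expgnFr.
exists (J i - J j)%N, y^-1; rewrite subn_gt0 !inE eqxx orbT; split=> //.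
by rewrite expgVn_mulV expgnFr 1?ltnW // invgM invgK.
Qed.


Lemma lenVX f n : len (f^-1 ^+ n) = len (f ^+ n).
Proof. by rewrite expgVn_mulV (lenV hl). Qed.

Lemma expg_neq1 f n : f <> 1 -> (0 < n)%N -> f ^+ n <> 1.
Proof.
by move=> f1 n0 fn; have := expg_inj_torsion_free tf f1 (i := n) (j := 0) fn; lia.
Qed.

(** The length of f^n grows linearly, at a rate that a bounded error cannot
change. *)
Lemma loxodromic_gap c e f k l : loxodromic c f -> f <> 1 ->
  (forall n, (len (f ^+ (l * n)) <= len (f ^+ (k * n)) + e)%N) -> (l <= k)%N.
Proof.
move=> lf f1 H; rewrite leqNgt; apply/negP => kl.
have flk : f ^+ (l - k) <> 1 by apply: (expg_neq1 f1); lia.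
have [n _ Tn] := unbounded_powers hl tf (c + e + 1) flk.
have := loxodromicD hl ((l - k) * n) (k * n) lf.
rewrite -mulnDl (subnK (ltnW kl)) => lD.
by rewrite -expgnA in Tn; have := H n; glia.
Qed.

(** Conjugation changes lengths by a bounded amount, so that k = r by comparing the
growth of both sides; then p^-1 z^(k n) p is longer than z^(k n) by almost
2 len p, which the equality of lengths forbids. *)
Lemma shortest_no_relation eta M c f p r k z : is_subgroup M ->
  near_geodesics len eta M -> M f -> f <> 1 -> loxodromic c f ->
  shortest len M p -> (2 * (2 * eta + 2 * D + 1) + D < 2 * len p)%N ->
  (0 < r)%N -> z \in [:: f; f^-1] ->
  (forall n, len (p^-1 * z ^+ (k * n) * p) = len (f ^+ (r * n))) -> False.
Proof.
move=> sM qM Mf f1 lf sp lp r0 zf H.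
have Mz : M z by move: zf; rewrite !inE => /orP[]/eqP->; last exact: subV.
have lz n : len (z ^+ n) = len (f ^+ n).
  by move: zf; rewrite !inE => /orP[]/eqP-> //; rewrite lenVX.
have kr : (k <= r)%N.
  apply: (loxodromic_gap (e := 2 * len p) lf f1) => n.
  have := len_conj hl p^-1 (p^-1 * z ^+ (k * n) * p).
  by rewrite H -(lz (k * n)%N) (lenV hl) !gcancel.
have rk : (r <= k)%N.
  apply: (loxodromic_gap (e := 2 * len p) lf f1) => n.
  by have := len_conj hl p (z ^+ (k * n)); rewrite H lz.
have {kr rk} erk : r = k by lia.
have fr : f ^+ r <> 1 by exact: expg_neq1.
have [n _ Tn] := unbounded_powers hl tf (2 * eta + 2 * D + 1 + D + 1) fr.
rewrite -expgnA in Tn.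
have Mzk : M (z ^+ (k * n)) by exact: subX.
have := len_conj_ge hl (shortest_diverge hl sM qM sp Mzk)
  (shortest_diverge hl sM qM sp (subV sM Mzk)).
by rewrite H lz -erk => ?; glia.
Qed.

(** The four rays of powers of f, f^-1, g and g^-1 diverge from each other, that is,
f and g are loxodromic without common end. *)
Definition independent c f g : Prop :=
  [/\ loxodromic c f, loxodromic c g &
      forall x y, x \in [:: f; f^-1] -> y \in [:: g; g^-1] ->
      forall n m, diverge c (x ^+ n) (y ^+ m)].

Lemma independent_sym c f g : independent c f g -> independent c g f.
Proof.
move=> [lf lg fg]; split=> // x y xg yf n m.
by apply: (diverge_sym hl); apply: fg.
Qed.

Lemma loxodromic_weak c e f : (c <= e)%N -> loxodromic c f -> loxodromic e f.
Proof. by move=> ce lf n m; apply: diverge_weak (lf n m). Qed.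

Lemma independentX c f g k l : independent c f g -> independent c (f ^+ k) (g ^+ l).
Proof.
have powE h i x : x \in [:: h ^+ i; (h ^+ i)^-1] ->
    exists2 z, z \in [:: h; h^-1] & forall n, x ^+ n = z ^+ (i * n).
  rewrite !inE => /orP[]/eqP->.
    by exists h => [|n]; rewrite ?inE ?eqxx // -expgnA.
  by exists h^-1 => [|n]; rewrite ?inE ?eqxx ?orbT // expgnA -expgVn_mulV.
move=> [lf lg fg]; split; [exact: loxodromicX|exact: loxodromicX|].
move=> x y /powE[x' xf xE] /powE[y' yg yE] n m.
by rewrite xE yE; apply: fg.
Qed.

Lemma independent_conj eta M c f p : is_subgroup M ->
  near_geodesics len eta M -> M f -> f <> 1 -> loxodromic c f ->
  shortest len M p -> (2 * (2 * eta + 2 * D + 1) + D < 2 * len p)%N ->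
  exists e, independent e f (p^-1 * f * p).
Proof.
move=> sM qM Mf f1 lf sp lp; set g := p^-1 * f * p.
have pair x y : x \in [:: f; f^-1] -> y \in [:: f; f^-1] ->
    exists C, forall n m, diverge C (x ^+ n) (p^-1 * y ^+ m).
  move=> xf yf; apply: contrapT => nC.
  have inv z : z \in [:: f; f^-1] -> z^-1 \in [:: f; f^-1] /\ loxodromic c z.
    by rewrite !inE => /orP[]/eqP->; split=> //;
      rewrite ?invgK ?eqxx ?orbT //; exact: (loxodromicV hl).
  have [|r [k [z [r0 zy rel]]]] := @fellow_travel_relation c p x y
      (inv _ xf).2 (inv _ yf).2.
    move=> C; apply: contrapT => nC'; apply: nC; exists C => n m.
    by apply: contrapT => ?; apply: nC'; exists n, m.
  have zf : z \in [:: f; f^-1].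
    by move: zy; rewrite !inE => /orP[]/eqP->; [|have := (inv _ yf).1];
      move: yf; rewrite !inE.
  apply: (shortest_no_relation (r := r) (k := k) sM qM Mf f1 lf sp lp r0 zf).
  move=> n; rewrite expgnA -conj_exp rel -expgnA.
  by move: xf; rewrite !inE => /orP[]/eqP->; rewrite ?lenVX.
have mem1 : f \in [:: f; f^-1] by rewrite !inE eqxx.
have mem2 : f^-1 \in [:: f; f^-1] by rewrite !inE eqxx orbT.
have [C1 H1] := pair _ _ mem1 mem1. have [C2 H2] := pair _ _ mem1 mem2.
have [C3 H3] := pair _ _ mem2 mem1. have [C4 H4] := pair _ _ mem2 mem2.
have gV : g^-1 = p^-1 * f^-1 * p by rewrite /g !gcancel.
pose e := (c + C1 + C2 + C3 + C4 + 6 * len p)%N.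
have lg : loxodromic e g.
  move=> n m; rewrite gV !conj_exp.
  apply: (diverge_weak _ (diverge_sym hl (diverge_mulr hl p (diverge_sym hl
    (diverge_mulr hl p (diverge_shiftl hl (c := c) _)))))).
    by rewrite (lenV hl) /e; lia.
  by rewrite invgK mulVKg.
exists e; split=> //; first by apply: loxodromic_weak lf; rewrite /e; lia.
move=> x y; rewrite !inE => /orP[]/eqP-> /orP[]/eqP-> n m; rewrite ?gV conj_exp.
all: apply: (diverge_sym hl); apply: diverge_weak (diverge_mulr hl _ (diverge_sym hl _)); last first.
all: try exact: H1; try exact: H2; try exact: H3; try exact: H4.
all: rewrite /e; lia.
Qed.

End Independent.

(** * Free families *)

Section Family.
Variables (G : groupType) (len : G -> nat) (D : nat).
Hypothesis hl : hyperbolic_length len D.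
Hypothesis tf : torsion_free G.
Implicit Types (x y z u v b h p q f g : G) (c e n : nat) (M K : set G).
Local Notation diverge := (diverge len).
Local Notation loxodromic := (loxodromic len).
Local Notation independent := (independent len).

Lemma loxodromic_power_far c f B : loxodromic c f -> f <> 1 ->
  exists2 k, (0 < k)%N & forall n, (0 < n)%N -> (B <= len ((f ^+ k) ^+ n))%N.
Proof.
move=> lf f1; have [k k0 Bk] := unbounded_powers hl tf (B + c) f1.
exists k => // -[//|n] _; elim: n => [|n IHn]; first by rewrite expg1; lia.
have := loxodromicD hl 1%N n.+1 (loxodromicX k lf).
by rewrite expg1 add1n; lia.
Qed.

(** Letters are indexed by 'I_N * bool: (j, true) stands for the inverse of the
generator (j, false), and [mate] exchanges the two. *)
Definition mate N (i : 'I_N * bool) : 'I_N * bool := (i.1, ~~ i.2).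

(** Distinct positive exponents, one for each letter. *)
Definition slot N (i : 'I_N * bool) : nat := (2 * i.1 + i.2).+1.

Lemma slot_inj N : injective (@slot N).
Proof.
move=> [i a] [j b] /= [] e; have eij : i = j :> nat by case: a b e => [] [] /=; lia.
congr pair; first exact: val_inj.
by case: a b e => [] [] //=; lia.
Qed.

Lemma slot_le N (i : 'I_N * bool) : (slot i <= 2 * N)%N.
Proof. by case: i => i a; rewrite /slot /=; have := ltn_ord i; case: a => /=; lia. Qed.

Lemma mateK N : involutive (@mate N).
Proof. by case=> i a; rewrite /mate /= negbK. Qed.

(** Letters t i as long as wanted, each t (j, false) in K a_j K, that diverge from
each other and from u with the constant c, whatever their length. *)
Definition free_family_bound (N : nat) (a : 'I_N -> G) K c u : Prop := forall L,
  exists t : 'I_N * bool -> G,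
  [/\ forall j, exists k1 k2, [/\ K k1, K k2 & t (j, false) = k1 * a j * k2],
      forall i, t (mate i) = (t i)^-1,
      forall i, diverge c u (t i),
      forall i j, i <> j -> diverge c (t i) (t j) &
      forall i, (L <= len (t i))%N].

(** The letter (j, false) is hd b hd'^-1, where hd and hd' are the heads f^i g^n of
(j, false) and of its mate, and b is f a_j or f^-1 a_j.  Heads with different
exponents i diverge where the powers of f end.  The element b must not let the
two powers of g cancel; as the direction of a_j g^-n cannot be along both f and
f^-1, one of the two choices works.  The large n makes the heads dominate all
the other constants. *)
Lemma free_family_along (N : nat) (a : 'I_N -> G) K c f g : is_subgroup K ->
  K f -> K g -> g <> 1 -> independent c f g ->
  (forall n, (0 < n)%N -> (2 * c + 2 * D < len (f ^+ n))%N) ->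
  exists C, forall u, (forall n, diverge (c + D) u (f ^+ n)) ->
    free_family_bound a K C u.
Proof.
move=> sK Kf Kg g1 [lf lg fg] ff.
pose A := (\sum_j len (a j))%N; pose W := (2 * N * len f)%N.
pose c3 := (c + D + 4 * W)%N; pose c4 := (c3 + 2 * (len f + A))%N.
exists (c + 2 * W + 4 * D)%N => u uf L.
have [n n0 Ln] := unbounded_powers hl tf (L + 2 * c4 + 4 * W + 4 * D + 4 * c + 1) g1.
have Af j : (len (a j) <= A)%N by rewrite /A (bigD1 j) //= leq_addr.
have memf : f \in [:: f; f^-1] by rewrite !inE eqxx.
have memfV : f^-1 \in [:: f; f^-1] by rewrite !inE eqxx orbT.
have memg : g \in [:: g; g^-1] by rewrite !inE eqxx.
have memgV : g^-1 \in [:: g; g^-1] by rewrite !inE eqxx orbT.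
pose hd (i : 'I_N * bool) : G := f ^+ slot i * g ^+ n.
have slotW (i : 'I_N * bool) : (len (f ^+ slot i) <= W)%N.
  by apply: leq_trans (lenX hl f _) _; rewrite leq_mul // slot_le.
have fVg k m : diverge c (f ^+ k)^-1 (g ^+ m).
  by rewrite -expgVn_mulV; apply: fg.
have hd_long i : (L + 2 * c4 + 4 * W + 4 * D + 3 * c < len (hd i))%N.
  by have := diverge_lenM hl (fVg (slot i) n); rewrite /hd; glia.
have u_hd i : diverge (c + D + D) u (hd i).
  apply: (diverge_ext hl (uf _) (fVg _ _)).
  by have := ff (slot i) isT; lia.
have hd_lt (i j : 'I_N * bool) : (slot i < slot j)%N -> diverge (c + D + 2 * W) (hd i) (hd j).
  move=> ij; apply: (diverge_weak _ (diverge_shiftl hl (c := c + D) _)).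
    by have := slotW i; lia.
  rewrite /hd mulgA expg_sub 1?ltnW //.
  have gf k : diverge c (g ^+ n) (f ^+ k) by apply: (diverge_sym hl); apply: fg.
  apply: (diverge_ext hl (gf _) (fVg _ _)).
  by have := ff (slot j - slot i)%N; rewrite subn_gt0 => /(_ ij); lia.
have hd_hd i j : i <> j -> diverge (c + D + 2 * W) (hd i) (hd j).
  move=> ij; case: (ltngtP (slot i) (slot j)) => [/hd_lt//|/hd_lt/(diverge_sym hl)//|].
  by move/slot_inj.
have mid j : exists b, [/\ b \in [:: f * a j; f^-1 * a j] &
    diverge (c + D) (g ^+ n)^-1 (b * (g ^+ n)^-1)].
  have ff1 : diverge c f^-1 f by have := lf 1%N 1%N; rewrite !expg1.
  have step z : z \in [:: f; f^-1] ->
      diverge (c + D) (a j * (g ^+ n)^-1) z^-1 ->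
      diverge (c + D) (g ^+ n)^-1 (z * a j * (g ^+ n)^-1).
    move=> zf vz; rewrite -mulgA.
    have gz : diverge c (g ^+ n)^-1 z.
      rewrite -expgVn_mulV -[z]expg1; apply: (diverge_sym hl).
      by have := fg _ _ zf memgV 1%N n.
    apply: (diverge_ext hl gz (diverge_sym hl vz)).
    suff : len z = len f by have := ff 1%N isT; rewrite expg1; lia.
    by move: zf; rewrite !inE => /orP[]/eqP->; rewrite ?(lenV hl).
  case: (diverge_or hl (a j * (g ^+ n)^-1) ff1) => [|vf].
    by move/(step _ memf) => H; exists (f * a j); rewrite !inE eqxx.
  exists (f^-1 * a j); rewrite !inE eqxx orbT; split=> //.
  by apply: (step _ memfV); rewrite invgK.
have [b /all_and2[bE bP]] := choice mid.
have b_len j : (len (b j) <= len f + A)%N.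
  have := bE j; rewrite !inE => /orP[]/eqP->.
    by apply: leq_trans (lenM hl _ _) _; rewrite leq_add.
  by apply: leq_trans (lenM hl _ _) _; rewrite (lenV hl) leq_add.
have KbK j : exists k1, K k1 /\ b j = k1 * a j.
  have := bE j; rewrite !inE => /orP[]/eqP->; first by exists f.
  by exists f^-1; split=> //; exact: subV.
have tail i j k : diverge c3 (hd i)^-1 (b k * (hd j)^-1).
  rewrite /hd !invgM mulgA.
  apply: (diverge_weak _ (diverge_mulr hl _ (diverge_sym hl
           (diverge_mulr hl _ (diverge_sym hl (bP k)))))).
  by rewrite !(lenV hl) /c3; have := slotW i; have := slotW j; lia.
have tailV i j k : diverge c4 (hd i)^-1 ((b k)^-1 * (hd j)^-1).
  apply: (diverge_sym hl).
  apply: (diverge_weak _ (diverge_shiftl hl (c := c3) _)).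
    by rewrite (lenV hl) /c4; have := b_len k; lia.
  by rewrite invgK; apply: tail.
pose t (i : 'I_N * bool) :=
  if i.2 then (hd (i.1, false) * b i.1 * (hd (i.1, true))^-1)^-1
  else hd (i.1, false) * b i.1 * (hd (i.1, true))^-1.
have tE i : exists y, diverge c4 (hd i)^-1 y /\ t i = hd i * y.
  case: i => i []; rewrite /t /=.
    exists ((b i)^-1 * (hd (i, false))^-1); split; first exact: tailV.
    by rewrite !gcancel.
  exists (b i * (hd (i, true))^-1); rewrite mulgA; split=> //.
  by apply: diverge_weak (tail _ _ _); rewrite /c4; lia.
have grow e v i : (e <= L + 4 * W + 3 * D + 2 * c)%N -> diverge e v (hd i) -> diverge (e + D) v (t i).
  move=> eL vi; have [y [iy ->]] := tE i.
  by apply: (diverge_ext hl vi iy); have := hd_long i; lia.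
exists t; split.
- move=> j; have [k1 [Kk1 bj]] := KbK j; rewrite /t /= bj /hd.
  exists (f ^+ slot (j, false) * g ^+ n * k1), (hd (j, true))^-1; split.
  + by apply: (subM sK) => //; apply: (subM sK); apply: subX.
  + by apply: (subV sK); apply: (subM sK); apply: subX.
  + by rewrite /hd !gcancel.
- by case=> i []; rewrite /t /= ?invgK.
- by move=> i; apply: diverge_weak (grow _ _ i _ (u_hd i)); lia.
- move=> i j ij; have H := grow _ _ j _ (hd_hd i j ij).
  apply: diverge_weak (diverge_sym hl (grow _ _ i _ (diverge_sym hl (H _)))); lia.
- move=> i; have [y [iy ->]] := tE i.
  by have := diverge_lenM hl iy; have := hd_long i; lia.
Qed.

(** If u goes along the powers of f, then it diverges from those of g, and f and g
are exchanged.  This keeps the constant independent of u, which matters because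
u will be p^-1 for a p that is chosen after that constant. *)
Lemma free_family (N : nat) (a : 'I_N -> G) K c f g : is_subgroup K ->
  K f -> K g -> f <> 1 -> g <> 1 -> independent c f g ->
  exists C, forall u, free_family_bound a K C u.
Proof.
move=> sK Kf Kg f1 g1 fg0; have [lf lg _] := fg0.
have [k k0 fk] := loxodromic_power_far (2 * c + 2 * D + 1) lf f1.
have [l l0 gl] := loxodromic_power_far (2 * c + 2 * D + 1) lg g1.
have fg := independentX k l fg0.
have Kfk : K (f ^+ k) by exact: subX.
have Kgl : K (g ^+ l) by exact: subX.
have fk1 := expg_neq1 tf f1 k0; have gl1 := expg_neq1 tf g1 l0.
have [C1 H1] := @free_family_along N a K c _ _ sK Kfk Kgl gl1 fg
  ltac:(by move=> n /fk; lia).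
have [C2 H2] := @free_family_along N a K c _ _ sK Kgl Kfk fk1 (independent_sym hl fg)
  ltac:(by move=> n /gl; lia).
have weak C u : (C <= C1 + C2)%N -> free_family_bound a K C u ->
    free_family_bound a K (C1 + C2) u.
  move=> CC H L; have [t [ta tV ut tt tL]] := H L; exists t; split=> // i.
    exact: diverge_weak (ut i).
  by move=> j ij; apply: diverge_weak (tt i j ij).
exists (C1 + C2)%N => u.
have [uf|nuf] := pselect (forall n, diverge (c + D) u (f ^+ k ^+ n)).
  by apply: weak (H1 u uf); lia.
apply: weak (H2 u _); first by lia.
move: nuf => /existsNP[n nun] m.
have [_ _ fgP] := fg.
have d : diverge c ((f ^+ k) ^+ n) ((g ^+ l) ^+ m) by apply: fgP; rewrite !inE eqxx.
by case: (diverge_or hl u d).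
Qed.

End Family.

(** * Free products with a quasiconvex subgroup *)

Section FreeOver.
Variables (G : groupType) (len : G -> nat) (D : nat).
Hypothesis hl : hyperbolic_length len D.
Implicit Types (x y z u v b h p q f g : G) (M K : set G).
Local Notation diverge := (diverge len).

(** The letters s i are long and diverge from M, from each other, and from their
translates by M: there is no cancellation in s(mate i) h (s j) unless h = 1 and
i = j. *)
Record free_over M (c N : nat) (s : 'I_N * bool -> G) : Prop := FreeOver {
  free_mate : forall i, s (mate i) = (s i)^-1;
  free_diverge : forall h i, M h -> diverge c h (s i);
  free_divergeM : forall h i j, M h -> ~ (h = 1 /\ i = j) ->
    diverge c (s i) (h * s j);
  free_long : forall i, (4 * c + 8 * D < len (s i))%N }.

(** The letters are p (t i) p^-1, with p as in [shortest_conj] and t as in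
[free_family] for u = p^-1.  Since p^-1 h p is long for h in M different from 1,
the translates by h diverge near the end of p; for h = 1 the t i diverge from
each other.  The order of choices is: the constant C of the family, then p, and
last the length of the t i. *)
Lemma free_over_exists (tf : torsion_free G) eta M K N (a : 'I_N -> G) :
  is_subgroup M -> is_subgroup K -> M `<=` K -> near_geodesics len eta M ->
  (exists2 h, M h & h <> 1) -> ~ covered M K ->
  exists c s, free_over M c s /\
    forall j, exists k1 k2, [/\ K k1, K k2 & s (j, false) = k1 * a j * k2].
Proof.
move=> sM sK MK qM Mn1 ncov; pose c0 := (2 * eta + 2 * D + 1)%N.
have [f [cf [Mf f1 lf]]] := loxodromic_exists hl tf sM qM Mn1.
have [p0 [Kp0 sp0 lp0]] := far_shortest hl (c0 + D + 1) sM sK MK ncov.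
have [|e fg] := independent_conj hl tf sM qM Mf f1 lf sp0; first by rewrite -/c0; lia.
have Kf := MK _ Mf.
have Kg : K (p0^-1 * f * p0).
  by apply: (subM sK) => //; apply: (subM sK) => //; exact: subV.
have g1 : p0^-1 * f * p0 <> 1.
  move=> e1; apply: f1.
  by have := congr1 (fun z => p0 * z * p0^-1) e1; rewrite !gcancel.
have [C HC] := free_family hl tf a sK Kf Kg f1 g1 fg.
have [T HT] := shortest_conj hl tf (C + 3 * D + 1) sM qM.
have [p [Kp sp lp]] := far_shortest hl (T + c0 + C + 2 * D + 1) sM sK MK ncov.
pose c := (c0 + C + 4 * D + 6 * len p)%N.
have [t [ta tV ut tt tL]] := HC p^-1 (4 * c + 10 * D + 2 * len p + 2 * C + 1)%N.
pose s i := p * (t i * p^-1).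
have pt i : diverge (C + D) p^-1 (t i * p^-1).
  apply: (diverge_ext hl (ut i) (c := C)); last by have := tL i; lia.
  by rewrite -tV; apply: (diverge_sym hl).
exists c, s; split; last first.
  move=> j; have [k1 [k2 [Kk1 Kk2 tj]]] := ta j.
  exists (p * k1), (k2 * p^-1); split.
  - exact: subM.
  - by apply: (subM sK) => //; exact: subV.
  - by rewrite /s tj !gcancel.
split.
- by move=> i; rewrite /s tV !gcancel.
- move=> h i Mh; apply: diverge_weak (diverge_ext hl
    (shortest_diverge hl sM qM sp Mh) (pt i) _); rewrite -/c0; last by lia.
  by rewrite /c; lia.
- move=> h i j Mh hij; rewrite /s.
  have [h1|h1] := eqVneq h 1.
    have {}hij : i <> j by move=> ij; apply: hij.
    apply: diverge_weak (diverge_shiftl hl (c := C + 4 * len p) _).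
      by rewrite /c; lia.
    rewrite h1 mul1g mulKg; have pV := lenV hl p.
    have := diverge_mulr hl p^-1 (diverge_sym hl (diverge_mulr hl p^-1 (tt i j hij))).
    by move/(diverge_sym hl); apply: diverge_weak; rewrite pV; lia.
  have gam h' : M h' -> h' <> 1 -> (len h' + (C + 3 * D + 1) <= len (p^-1 * h' * p))%N.
    by apply: HT => //; lia.
  have side k h' : M h' -> h' <> 1 -> diverge (C + 2 * D) (t k * p^-1) (p^-1 * h' * p).
    move=> Mh' h'1; apply: diverge_weak (diverge_near hl (diverge_sym hl (pt k)) _).
      by lia.
    have := gam _ Mh' h'1; have := lenM hl h' p.
    by rewrite invgK !gcancel (lenV hl); glia.
  have hV1 : h^-1 <> 1 by move=> e1; case/eqP: h1; rewrite -(invgK h) e1 invg1.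
  move/eqP in h1; have S1 := side i h Mh h1; have S2 := side j h^-1 (subV sM Mh) hV1.
  have S3 : diverge (C + 2 * D) (p^-1 * h * p)^-1 (t j * p^-1).
    by apply: (diverge_sym hl); move: S2; rewrite !gcancel.
  have := diverge_ext hl S1 S3; have := gam _ Mh h1 => ? /(_ ltac:(lia)) S4.
  apply: diverge_weak (diverge_shiftl hl (c := C + 3 * D) _).
    by rewrite /c; lia.
  by move: S4; rewrite !gcancel => S4; apply: diverge_weak S4; lia.
- move=> i; rewrite /s; have := tL i; have := len_mul_ger hl p (t i * p^-1).
  by have := len_mul_ge hl (t i) p^-1; rewrite (lenV hl); glia.
Qed.

End FreeOver.

(** * Normal forms *)

Section FreeJoin.
Variables (G : groupType) (len : G -> nat) (D : nat).
Hypothesis hl : hyperbolic_length len D.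
Variables (M : set G) (c N : nat) (s : 'I_N * bool -> G).
Hypothesis sM : is_subgroup M.
Hypothesis fs : free_over len D M c s.
Implicit Types (x y z u v b h p q f g : G) (i j : 'I_N * bool).
Implicit Types (d e : G * ('I_N * bool)) (w : seq (G * ('I_N * bool))).
Local Notation diverge := (diverge len).

Definition syllable e : G := e.1 * s e.2.

Definition eval w : G := \prod_(x <- map syllable w) x.

(** The letter of e follows that of d; they cancel only if they are mutually inverse
and the element of M between them, which is e.1, is 1. *)
Definition no_cancel d e : bool := ~~ ((e.1 == 1) && (e.2 == mate d.2)).

Definition reduced w : bool := sorted no_cancel w.

(** The subgroup generated by L and the letters with index in J, given by reduced
words. *)
Definition free_join (L : set G) (J : set ('I_N * bool)) : set G :=
  [set g | exists w h, [/\ reduced w,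
     forall e, e \in w -> L e.1 /\ J e.2, L h & g = eval w * h]].

Lemma eval_cons e w : eval (e :: w) = e.1 * (s e.2 * eval w).
Proof. by rewrite /eval /= gprod_cons !gcancel. Qed.

Lemma eval_nil : eval [::] = 1.
Proof. exact: gprod0. Qed.

Lemma reduced_head e d w : e.2 = d.2 -> reduced (e :: w) -> reduced (d :: w).
Proof. by case: w => //= x w; rewrite /reduced /= /no_cancel => ->. Qed.

Section FreeJoinSubgroup.
Variables (L : set G) (J : set ('I_N * bool)).
Hypothesis sL : is_subgroup L.
Hypothesis J_mate : forall i, J i -> J (mate i).

Lemma free_join_base h : L h -> free_join L J h.
Proof. by move=> Lh; exists [::], h; split=> //; rewrite eval_nil mul1g. Qed.

Lemma free_join_mul_base h g : L h -> free_join L J g -> free_join L J (h * g).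
Proof.
move=> Lh [[|e w] [k [rw Lw Lk ->]]].
  exists [::], (h * k); split=> //; first exact: subM.
  by rewrite eval_nil !mul1g.
exists ((h * e.1, e.2) :: w), k; split=> //; first exact: reduced_head rw.
  move=> d; rewrite inE => /orP[/eqP->|dw] /=.
    have [Le Je] := Lw e (mem_head _ _); split=> //; exact: subM.
  by apply: Lw; rewrite inE dw orbT.
by rewrite !eval_cons /= !gcancel.
Qed.

(** Prepending a letter either keeps the word reduced or cancels its first letter,
so that words never have to be reduced. *)
Lemma free_join_mul_gen i g : J i -> free_join L J g -> free_join L J (s i * g).
Proof.
move=> Ji [w [k [rw Lw Lk ->]]].
have [rc|] := boolP (reduced ((1, i) :: w)).
  exists ((1, i) :: w), k; split=> //.
    move=> d; rewrite inE => /orP[/eqP->|/Lw//] /=; split=> //; exact: sub1.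
  by rewrite eval_cons /= !gcancel.
case: w rw Lw => [//|e w] rw Lw; rewrite /reduced /= in rw *; rewrite rw andbT negbK.
case/andP=> /eqP e1 /eqP e2; exists w, k; split=> //.
- exact: path_sorted rw.
- by move=> d dw; apply: Lw; rewrite inE dw orbT.
- by rewrite eval_cons e1 e2 (free_mate fs) !gcancel.
Qed.

Lemma free_join_gen i : J i -> free_join L J (s i).
Proof.
by move=> Ji; rewrite -[s i]mulg1; apply: free_join_mul_gen => //; exact: (free_join_base (sub1 sL)).
Qed.

Lemma free_join_subgroup : is_subgroup (free_join L J).
Proof.
have act w h : (forall e, e \in w -> L e.1 /\ J e.2) -> L h -> forall g, free_join L J g ->
    free_join L J (eval w * h * g) /\ free_join L J ((eval w * h)^-1 * g).
  elim: w => [|e w IHw] Lw Lh g Sg.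
    rewrite eval_nil !mul1g; split; apply: free_join_mul_base => //; exact: subV.
  have [Le Je] := Lw e (mem_head _ _).
  have {}IHw := IHw (fun d dw => Lw d ltac:(by rewrite inE dw orbT)) Lh.
  rewrite eval_cons; split.
    have -> : e.1 * (s e.2 * eval w) * h * g = e.1 * (s e.2 * (eval w * h * g)).
      by rewrite !gcancel.
    apply: free_join_mul_base => //; apply: free_join_mul_gen => //; exact: (IHw g Sg).1.
  have -> : (e.1 * (s e.2 * eval w) * h)^-1 * g =
      (eval w * h)^-1 * (s (mate e.2) * (e.1^-1 * g)).
    by rewrite (free_mate fs) !gcancel.
  apply: (IHw _ _).2; apply: free_join_mul_gen; first exact: J_mate.
  by apply: free_join_mul_base => //; exact: subV.
apply/is_subgroupP; split; first exact: (free_join_base (sub1 sL)).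
move=> x y Sx [w [h [_ Lw Lh ->]]].
have xS := (act w h Lw Lh 1 (free_join_base (sub1 sL))).2.
rewrite mulg1 in xS; move: Sx => [w' [h' [_ Lw' Lh' ->]]].
exact: (act w' h' Lw' Lh' _ xS).1.
Qed.

Lemma free_join_prod w : (forall e, e \in w -> L e.1 /\ J e.2) -> free_join L J (eval w).
Proof.
elim: w => [|e w IHw] Lw; first by rewrite eval_nil; exact: (free_join_base (sub1 sL)).
have [Le Je] := Lw e (mem_head _ _); rewrite eval_cons.
apply: free_join_mul_base => //; apply: free_join_mul_gen => //; apply: IHw => d dw.
by apply: Lw; rewrite inE dw orbT.
Qed.

End FreeJoinSubgroup.

(** A syllable h (s i) ends as s i does. *)
Lemma diverge_syllable h i u : M h -> diverge c u (s (mate i)) ->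
  diverge (c + D) (h * s i)^-1 u.
Proof.
move=> Mh us; rewrite invgM -(free_mate fs); apply: (diverge_sym hl).
have si : diverge c (s (mate i))^-1 h^-1.
  rewrite (free_mate fs) invgK; apply: (diverge_sym hl).
  by apply: (free_diverge fs); exact: subV.
by apply: (diverge_ext hl us si); have := free_long fs (mate i); lia.
Qed.

Lemma len_syllable h i : M h -> (3 * c + 8 * D < len (h * s i))%N.
Proof.
move=> Mh; have := diverge_lenM hl (free_diverge fs i (subV sM Mh)) => H.
have := free_long fs i; have : diverge c h^-1 (s i) by apply: (free_diverge fs); exact: subV.
by move/(diverge_lenM hl); glia.
Qed.

Lemma reduced_chain e w h : reduced (e :: w) ->
  (forall d, d \in e :: w -> M d.1) -> M h ->
  path (chain_step len D (c + D)) (syllable e) (rcons (map syllable w) h).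
Proof.
move=> + + Mh; elim: w e => [|d w IHw] e /= rw Mw; have Me := Mw e (mem_head _ _).
  rewrite andbT /chain_step /syllable; apply/andP; split.
    by have := len_syllable e.2 Me; lia.
  by apply: diverge_syllable => //; apply: (free_diverge fs).
case/andP: rw => ed rw; rewrite IHw // => [|d' d'w]; last by apply: Mw; rewrite inE d'w orbT.
have Md : M d.1 by apply: Mw; rewrite !inE eqxx orbT.
rewrite andbT /chain_step /syllable; apply/andP; split.
  by have := len_syllable e.2 Me; lia.
apply: diverge_syllable => //; apply: (diverge_sym hl); apply: (free_divergeM fs) => //.
by case=> d1 ed2; move: ed; rewrite /no_cancel d1 eqxx -ed2 eqxx.
Qed.

(** The normal form theorem: an element m of M can be absorbed in the first
syllable, so that it is enough to see that a reduced word is not 1, and it has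
positive length. *)
Lemma reduced_notin e w : reduced (e :: w) -> (forall d, d \in e :: w -> M d.1) ->
  ~ M (eval (e :: w)).
Proof.
move=> rw Mw Mev; set m := eval (e :: w) in Mev.
have rw' : reduced ((m^-1 * e.1, e.2) :: w) by exact: reduced_head rw.
have Mw' d : d \in (m^-1 * e.1, e.2) :: w -> M d.1.
  rewrite inE => /orP[/eqP->|dw] /=; last by apply: Mw; rewrite inE dw orbT.
  by apply: (subM sM); [exact: subV | exact/Mw/mem_head].
have := chain_head hl (reduced_chain rw' Mw' (sub1 sM)).
have -> : syllable (m^-1 * e.1, e.2) *
    \prod_(x <- rcons (map syllable w) 1) x = 1.
  rewrite -cats1 gprod_cat gprod1 mulg1 -/(eval w) /syllable /= -!mulgA.
  by rewrite -eval_cons -/m mulVg.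
have := len_syllable e.2 (Mw' _ (mem_head _ _)).
by rewrite (len1 hl) /syllable /=; lia.
Qed.

Lemma free_join_proper L J i : is_subgroup L -> L `<=` M ->
  (forall j, J j -> J (mate j)) -> ~ J i -> ~ free_join L J (s i).
Proof.
move=> sL LM JV nJi [w [h [rw Lw Lh e]]].
apply: (@reduced_notin (1, mate i) w).
- case: w rw Lw {e} => //= d w rw Lw; rewrite rw andbT /no_cancel /= mateK.
  apply/negP => /andP[_ /eqP di]; apply: nJi; rewrite -di.
  exact: (Lw d (mem_head _ _)).2.
- move=> d; rewrite inE => /orP[/eqP->|/Lw[/LM//]] /=; exact: sub1.
- have ew : eval w = s i * h^-1 by rewrite e mulgK.
  by rewrite eval_cons (free_mate fs) ew !gcancel; apply: (subV sM); exact: LM.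
Qed.

(** A point of a geodesic from 1 to the value of a reduced word is near an edge of
the broken geodesic of that word, by [between_chain].  Up to the bounded length
of the letters the edge is a translate of a geodesic from 1 to an element of L,
so that quasiconvexity of L applies. *)
Lemma free_join_near_geodesics eta L (J : set ('I_N * bool)) : is_subgroup L -> L `<=` M ->
  (forall j, J j -> J (mate j)) -> near_geodesics len eta L ->
  exists r, near_geodesics len r (free_join L J).
Proof.
move=> sL LM JV qL; pose E := (c + 5 * D)%N.
have [B BP] : exists B, forall i, (len (s i) <= B)%N.
  by exists (\sum_i len (s i))%N => i; rewrite (bigD1 i) //= leq_addr.
exists (eta + (E + 2 * B) + D)%N => _ x [w [h [rw Lw Lh ->]]].
case: w rw Lw => [|e w] rw Lw.
  rewrite eval_nil mul1g => hx; have [m Lm xm] := qL h x Lh hx.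
  by exists m; [exact: free_join_base | lia].
have Mw d : d \in e :: w -> M d.1 by case/Lw => /LM.
have := reduced_chain rw Mw (LM _ Lh).
set W := rcons (map syllable (e :: w)) h => ch.
pose X k := \prod_(y <- take k W) y.
have eW : eval (e :: w) * h = X (size W) by rewrite /X take_size /W -cats1 gprod_cat gprod1.
rewrite eW => bx.
have XV k : (X k)^-1 * X (size W) = \prod_(y <- drop k W) y.
  by rewrite /X take_size -{2}(cat_take_drop k W) gprod_cat mulKg.
have [|||k kW] := @between_chain _ _ _ hl (c + 3 * D) 0 X (size W) x _ _ _ bx.
- by rewrite size_rcons.
- by rewrite /X take0 gprod0.
- move=> k _; rewrite XV /X take_size; case: k => [|k].
    by rewrite take0 drop0 gprod0 (len1 hl); lia.
  move: ch; rewrite /W /= -{1}(cat_take_drop k (rcons _ h)) => /(chain_split hl).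
  rewrite cat_take_drop -!gprod_cons => H.
  by rewrite (_ : (c + 3 * D = (c + D) + 2 * D)%N); [rewrite addnA | lia].
have kw : (k <= size (e :: w))%N by move: kW; rewrite size_rcons size_map.
have SX : free_join L J (X k).
  rewrite /X /W -cats1 takel_cat ?size_map // -map_take.
  by apply: free_join_prod => // d /mem_take/Lw.
have -> : X k.+1 = X k * nth 1 W k.
  by rewrite /X (take_nth 1) // -cats1 gprod_cat gprod1.
move=> bk.
have [l Ll bl] : exists2 l, L l & between len (E + 2 * B) 1 l ((X k)^-1 * x).
  have [lt_k|ge_k] := ltnP k (size (e :: w)).
    have dw : nth (1, e.2) (e :: w) k \in e :: w by exact: mem_nth.
    move: bk; rewrite /W nth_rcons size_map lt_k (nth_map (1, e.2)) //.
    move: dw; move: (nth _ _ k) => [l i] dl; exists l; first exact: (Lw (l, i) dl).1.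
    have si := BP i; move: bk; rewrite /between /syllable /= !gcancel.
    have := lenM hl l (s i).
    have := len_mul_ge hl (x^-1 * X k * l) (s i).
    by rewrite /E; glia.
  exists h => //; move: bk; rewrite /W nth_rcons size_map ltnNge ge_k /=.
  rewrite (_ : k == size (e :: w)); last by rewrite eqn_leq kw.
  by rewrite /between !gcancel /E; glia.
have [m Lm lm] := near_quasigeodesic hl qL Ll bl.
exists (X k * m); first by apply: (subM (free_join_subgroup sL JV)) => //; exact: free_join_base.
by move: lm; rewrite !gcancel; glia.
Qed.

Lemma free_join_long L J g : L `<=` M -> free_join L J g -> ~ L g ->
  exists i, (len (s i) <= len g + 2 * c + 2 * D)%N.
Proof.
move=> LM [[|e w] [h [rw Lw Lh ->]]] nL.
  by case: nL; rewrite eval_nil mul1g.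
have Mw d : d \in e :: w -> M d.1 by case/Lw => /LM.
exists e.2; have := chain_head hl (reduced_chain rw Mw (LM _ Lh)).
have -> : syllable e * \prod_(x <- rcons (map syllable w) h) x =
    eval (e :: w) * h.
  by rewrite -cats1 gprod_cat gprod1 /eval /= gprod_cons mulgA.
have Me := Mw e (mem_head _ _).
have := diverge_lenM hl (free_diverge fs e.2 (subV sM Me) : diverge c e.1^-1 _).
by rewrite /syllable; glia.
Qed.

(** Otherwise (k (s i))^-r times a word over L would be in M.  It is reduced over M
as it stands: k^-1 separates the letters s(mate i), and the syllable where the
two words meet has k^-1 l with l in L, which is not 1.  The product is taken one
factor at a time, on the left. *)
Lemma free_join_power L J i k r : is_subgroup L -> L `<=` M -> M k -> ~ L k ->
  (0 < r)%N -> ~ free_join L J ((k * s i) ^+ r).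
Proof.
move=> sL LM Mk nLk r0 [w [h [rw Lw Lh e]]].
have MkV : M k^-1 by exact: subV.
have [w' [h' [szw rw' Mw' _ [Mh' ew']]]] : exists w' h',
    [/\ (r <= size w')%N, reduced w', forall d, d \in w' -> M d.1,
        (if w' is d :: _ then d.1 <> 1 else True) & M h' /\
        eval w' * h' = k^-1 * ((s i)^-1 * k^-1) ^+ r * (eval w * h)].
  elim: (r) => [|n [w' [h' [szw rw' Mw' hd [Mh' ew']]]]].
    case: w rw Lw {e} => [|d w] rw Lw.
      exists [::], (k^-1 * h); split=> //; split; first by apply: subM => //; exact: LM.
      by rewrite eval_nil expg0 !gcancel.
    exists ((k^-1 * d.1, d.2) :: w), h; split=> //=.
    - exact: reduced_head rw.
    - move=> d'; rewrite inE => /orP[/eqP->|d'w] /=.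
        by apply: subM => //; have [/LM] := Lw d (mem_head _ _).
      by have [|/LM] := Lw d'; first by rewrite inE d'w orbT.
    - move=> /mulg1_eq; rewrite invgK => dk; apply: nLk; rewrite dk.
      by have [] := Lw d (mem_head _ _).
    - by split; [exact: LM | rewrite !eval_cons expg0 /= !gcancel].
  exists ((k^-1, mate i) :: w'), h'; split=> //.
  - case: w' rw' hd {szw Mw' ew'} => //= d w' rw' hd; rewrite /reduced /= in rw' *.
    by rewrite rw' andbT /no_cancel; have /eqP/negPf-> := hd.
  - by move=> d; rewrite inE => /orP[/eqP->//|/Mw'].
  - by move=> /= k1; apply: nLk; rewrite -(invgK k) k1 invg1; exact: sub1.
  - by split=> //; rewrite eval_cons /= (free_mate fs) gexpS -!mulgA ew' !gcancel.
case: w' szw rw' Mw' ew' => [|d w'] szw rw' Mw' ew'; first by rewrite ltnNge szw in r0.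
apply: (reduced_notin rw' Mw').
have -> : eval (d :: w') = k^-1 * h'^-1.
  apply: (mulIg h'); rewrite ew' -e mulgVK -invgM expgVn_mulV mulgVK //.
by apply: subM => //; exact: subV.
Qed.

End FreeJoin.

(** * The word metric *)

Section WordMetric.
Variables (G : groupType) (A : set G).
Hypothesis finite_gen : finite_symmetrized_generating_set A.
Implicit Types (x y z u v g h q : G) (s t p : seq G).
Local Notation len := (word_length A).

Lemma is_word_cat s t x y : is_word A s x -> is_word A t y -> is_word A (s ++ t) (x * y).
Proof.
move=> [As <-] [At <-]; split; last exact: gprod_cat.
by move=> a; rewrite mem_cat => /orP[/As|/At].
Qed.

Lemma is_word_rev s x : is_word A s x -> is_word A (map (@monoid.inv G) (rev s)) x^-1.
Proof.
have [_ AV _] := finite_gen; move=> [As <-]; split.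
  by move=> b /mapP[a]; rewrite mem_rev => /As/AV Aa ->.
by rewrite big_map prodgV revK.
Qed.

Lemma word_lengthP g :
  (exists2 s, is_word A s g & size s = len g) /\
  (forall s, is_word A s g -> (len g <= size s)%N).
Proof.
have [_ _ gen] := finite_gen; rewrite /word_length.
case: xgetP => [n _ //|noneP]; have [s sg] := gen g.
have ex : exists n, `[< exists2 s, is_word A s g & size s = n >].
  by exists (size s); apply/asboolP; exists s.
have [n /asboolP nP nmin] := ex_minnP ex.
case: (noneP n); split=> // t tg; apply: nmin.
by apply/asboolP; exists t.
Qed.

Lemma word_length_word g : exists2 s, is_word A s g & size s = len g.
Proof. exact: (word_lengthP g).1. Qed.

Lemma word_length_le s g : is_word A s g -> (len g <= size s)%N.
Proof. exact: (word_lengthP g).2. Qed.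

Lemma word_length1 : len 1 = 0%N.
Proof.
apply/eqP; rewrite -leqn0; apply: (@word_length_le [::]).
by split=> //; rewrite big_nil.
Qed.

Lemma word_lengthV x : len x^-1 = len x.
Proof.
have le y : (len y^-1 <= len y)%N.
  have [s /is_word_rev sV <-] := word_length_word y.
  by have := word_length_le sV; rewrite size_map size_rev.
by apply/eqP; rewrite eqn_leq le -{1}(invgK x) le.
Qed.

Lemma word_lengthM x y : (len (x * y) <= len x + len y)%N.
Proof.
have [s sx <-] := word_length_word x; have [t ty <-] := word_length_word y.
by rewrite -size_cat; apply: word_length_le; exact: is_word_cat.
Qed.

Lemma word_length_ball n : exists F : seq G, forall x, (len x <= n)%N -> x \in F.
Proof.
have [/finite_seqP[S AS] _ _] := finite_gen.
suff [F FP] : exists F : seq G, forall s x, is_word A s x -> (size s <= n)%N -> x \in F.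
  exists F => x; have [s sx <-] := word_length_word x; exact: FP.
elim: n => [|n [F FP]].
  by exists [:: 1] => -[|//] x [_ <-] _; rewrite big_nil inE.
exists (F ++ [seq a * x | a <- S, x <- F]) => -[|a s] x [As <-] sn.
  by rewrite mem_cat (FP [::]).
rewrite mem_cat big_cons allpairs_f ?orbT //.
  by have := As a (mem_head _ _); rewrite AS.
by apply: (FP s) => //; split=> // b bs; apply: As; rewrite inE bs orbT.
Qed.

Lemma word_length_split x n : (n <= len x)%N ->
  exists2 y, len y = n & len (y^-1 * x) = (len x - n)%N.
Proof.
have [s [As sx] sl] := word_length_word x; rewrite -sl => ns.
exists (\prod_(a <- take n s) a).
  all: have h1 : (len (\prod_(a <- take n s) a) <= n)%N
    by rewrite -[leqRHS](size_takel ns); apply: word_length_le; split=> // a /mem_take/As.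
  all: have h2 : (len ((\prod_(a <- take n s) a)^-1 * x) <= size s - n)%N
    by rewrite -sx -{2}(cat_take_drop n s) gprod_cat mulKg -size_drop;
       apply: word_length_le; split=> // a /mem_drop/As.
  all: have := word_lengthM (\prod_(a <- take n s) a) ((\prod_(a <- take n s) a)^-1 * x).
  all: rewrite mulVKg -sl; move: h1 h2; move: (\prod_(a <- _) a) => y h1 h2 h3; lia.
Qed.

(** The hyperbolicity inequality at the base point 1, cleared of denominators and
rounded to natural numbers. *)
Lemma min_product_nat (d : rat) (D a b c e1 e2 e3 : nat) :
  (d * 2 <= D%:R ->
   Num.min ((a%:R + c%:R - e1%:R) / 2) ((c%:R + b%:R - e2%:R) / 2) - d <=
     (a%:R + b%:R - e3%:R) / 2)%R ->
  (d * 2 <= D%:R)%R -> (e3 + c <= maxn (e1 + b) (e2 + a) + D)%N.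
Proof.
move=> H dD; have {H} := H dD; rewrite -(ler_nat rat).
rewrite !natrD; rewrite /Num.min; case: ifP => _ H.
  apply: (@le_trans _ _ (e1%:R + b%:R + D%:R)%R); first by lra.
  by rewrite lerD2r -natrD ler_nat leq_maxl.
apply: (@le_trans _ _ (e2%:R + a%:R + D%:R)%R); first by lra.
by rewrite lerD2r -natrD ler_nat leq_maxr.
Qed.

Lemma word_length_hyperbolic : gromov_hyperbolic A ->
  exists D, hyperbolic_length len D.
Proof.
move=> [d d0 hyp]; exists (Num.bound (d * 2)%R); split.
- exact: word_length1.
- exact: word_lengthV.
- exact: word_lengthM.
- exact: word_length_ball.
- exact: word_length_split.
move=> x y z; have wd g : word_dist A g 1 = len g by rewrite /word_dist mulg1 word_lengthV.
have := hyp x y z 1; rewrite /gromov_product !wd /word_dist => H.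
have -> : len (z^-1 * x) = len (x^-1 * z) by rewrite -word_lengthV !gcancel.
apply: (@min_product_nat d) => [_|]; first exact: H.
by apply: ltW; apply: archi_boundP; lra.
Qed.

Lemma word_path u s : (forall a, a \in s -> A a) ->
  path (cayley_adj A) u (scanl *%g u s) /\
  last u (scanl *%g u s) = u * \prod_(a <- s) a.
Proof.
elim: s u => [|a s IHs] u As /=; first by rewrite gprod0 mulg1.
have [|pus lus] := IHs (u * a); first by move=> b bs; apply: As; rewrite inE bs orbT.
rewrite pus lus gprod_cons andbT /cayley_adj /= mulKg mulgA; split=> //.
by apply/mem_set/As/mem_head.
Qed.

Lemma word_dist_path u p : path (cayley_adj A) u p ->
  (len (u^-1 * last u p) <= size p)%N.
Proof.
elim: p u => [|v p IHp] u /=; first by rewrite mulVg word_length1.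
case/andP=> /set_mem Auv /IHp vp.
have luv : (len (u^-1 * v) <= 1)%N.
  apply: (@word_length_le [:: u^-1 * v]); split; last exact: big_seq1.
  by move=> a; rewrite inE => /eqP->.
have := word_lengthM (u^-1 * v) (v^-1 * last v p).
by rewrite !gcancel; glia.
Qed.

(** A point with additive distances lies on the geodesic word obtained by
concatenating two shortest words, and every vertex of a geodesic has additive
distances. *)
Lemma quasiconvexP Q : is_subgroup Q ->
  quasiconvex A Q <-> exists e, near_geodesics len e Q.
Proof.
move=> sQ; split=> -[e qQ]; exists e.
  move=> h x Qh; rewrite /between !gcancel => bx.
  have [s [As sx] sl] := word_length_word x.
  have [t [At tx] tl] := word_length_word (x^-1 * h).
  have Ast a : a \in s ++ t -> A a by rewrite mem_cat => /orP[/As|/At].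
  have [pst lst] := word_path 1 Ast.
  have [ps ls] := word_path 1 As.
  apply: (qQ 1 h (scanl *%g 1 (s ++ t))) => //; first exact: sub1.
    split=> //; first by rewrite lst gprod_cat sx tx !gcancel.
    rewrite size_scanl size_cat sl tl /word_dist invg1 mul1g.
    by have := word_lengthM x (x^-1 * h); rewrite mulVKg; glia.
  have -> : x = last 1 (scanl *%g 1 s) by rewrite ls sx mul1g.
  rewrite scanl_cat -cat_cons mem_cat mem_last //.
move=> u v p Qu Qv [pp lp sp] x xp.
have uvQ : Q (u^-1 * v) by apply: subM => //; exact: subV.
have [|m Qm xm] := qQ (u^-1 * v) (u^-1 * x) uvQ.
  rewrite /between !gcancel.
  case/splitPl: xp pp lp sp => p1 p2 <-; rewrite cat_path last_cat.
  case/andP=> /word_dist_path h1 /word_dist_path h2 lp.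
  by rewrite lp in h2; rewrite size_cat /word_dist addn0 => <-; exact: leq_add.
exists (u * m); first exact: subM.
by move: xm; rewrite /word_dist !gcancel.
Qed.

End WordMetric.

(** * Profinite closure *)

Section ProfiniteClosure.
Variable G : groupType.
Implicit Types (H K P M : set G) (g h k x : G).

(** The closure of a subgroup H in the profinite topology. *)
Definition pclosure H : set G :=
  [set k | forall P, is_subgroup P -> finite_index P -> H `<=` P -> P k].

Lemma sub_pclosure H : H `<=` pclosure H.
Proof. by move=> h Hh P _ _; apply. Qed.

Lemma pclosure_min H P : is_subgroup P -> finite_index P -> H `<=` P ->
  pclosure H `<=` P.
Proof. by move=> sP fP HP k; apply. Qed.

Lemma pclosure_mono H K : H `<=` K -> pclosure H `<=` pclosure K.
Proof. by move=> HK k kH P sP fP KP; apply: kH => // x /HK/KP. Qed.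

Lemma pclosure_subgroup H : is_subgroup (pclosure H).
Proof.
apply/is_subgroupP; split; first by move=> P sP _ _; exact: sub1.
move=> x y Hx Hy P sP fP HP.
by apply: subM => //; [exact: Hx | apply: subV => //; exact: Hy].
Qed.

Lemma finite_indexP P : is_subgroup P ->
  finite_index P <-> exists F : seq G, forall g, exists2 f, f \in F & P (f^-1 * g).
Proof.
move=> sP; have lcosetP f g : lcoset f P = lcoset g P -> P (f^-1 * g).
  by move/(lcoset_eqP f g sP).2 => [x Px <-]; rewrite mulKg.
split=> [/finite_seqP[S SE]|[F FP]].
  exists [seq xget 1 [set g | lcoset g P = X] | X <- S] => g.
  have gS : lcoset g P \in S.
    have : range (lcoset^~ P) (lcoset g P) by exists g.
    by rewrite [X in X _]SE.
  exists (xget 1 [set h | lcoset h P = lcoset g P]); first exact: map_f.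
  by apply: lcosetP; case: xgetP => [h _ //|/(_ g)]; case.
apply: (@sub_finite_set _ _ (lcoset^~ P @` [set` F])); last first.
  by apply: finite_image; exact: finite_seq.
move=> _ [g _ <-]; have [f fF Pf] := FP g; exists f => //.
by apply/(lcoset_eqP f g sP); exists (f^-1 * g); rewrite ?mulVKg.
Qed.

Lemma covered_finite_index M : is_subgroup M -> covered M setT -> finite_index M.
Proof.
move=> sM [F FP]; apply/finite_indexP => //; exists (map (@monoid.inv G) F) => g.
have [//|f fF Mf] := FP g^-1; exists f^-1; first exact: map_f.
by have := subV sM Mf; rewrite !gcancel.
Qed.

Lemma covered_trans H K M : is_subgroup H -> covered H K -> covered K M -> covered H M.
Proof.
move=> sH [F1 H1] [F2 H2]; exists [seq x * y | x <- F1, y <- F2] => m Mm.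
have [f2 f2F /H1[f1 f1F Hf]] := H2 m Mm.
by exists (f1 * f2); [exact: allpairs_f | move: Hf; rewrite !gcancel].
Qed.

(** The core is the intersection of the conjugates of P, of which there are finitely
many: one for each coset of P. *)
Lemma normal_core P : is_subgroup P -> finite_index P ->
  exists N, [/\ is_subgroup N, is_normal N, finite_index N & N `<=` P].
Proof.
move=> sP fP; have [F FP] := (finite_indexP sP).1 fP.
pose C f : set G := [set x | P (x ^ f)].
have sC f : is_subgroup (C f).
  apply/is_subgroupP; rewrite /C; split=> [|x y Px Py] /=.
    by rewrite conj1g; exact: sub1.
  by rewrite conjMg conjVg; apply: subM => //; exact: subV.
have fC f : finite_index (C f).
  apply/finite_indexP => //; exists [seq f * g * f^-1 | g <- F] => g.
  have [h hF Ph] := FP (g ^ f); exists (f * h * f^-1); first exact: map_f.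
  by move: Ph; rewrite /C /= !conjgE !gcancel.
have [N [sN fN NP]] : exists N, [/\ is_subgroup N, finite_index N &
    forall x, N x <-> forall f, f \in F -> P (x ^ f)].
  elim: (F) => [|f F' [N [sN fN NP]]].
    exists setT; split=> //; first exact/is_subgroupP.
    by apply: covered_finite_index; [exact/is_subgroupP | exists [:: 1] => k _; exists 1; rewrite ?inE].
  exists (C f `&` N); split.
  - apply/is_subgroupP; split; first by split; exact: sub1.
    by move=> x y [Cx Nx] [Cy Ny]; split; apply: subM => //; exact: subV.
  - exact: finite_indexI.
  - move=> x; split=> [[Cx /NP Nx] g|H]; first by rewrite inE => /orP[/eqP->|/Nx].
    split; first by apply: H; rewrite mem_head.
    by apply/NP => g gF; apply: H; rewrite inE gF orbT.
have NE x : N x <-> forall g, P (x ^ g).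
  split=> [/NP Nx g|H]; last by apply/NP => f _; exact: H.
  have [f fF Pf] := FP g.
  have -> : x ^ g = (x ^ f) ^ (f^-1 * g) by rewrite -conjgM mulVKg.
  rewrite conjgE; apply: (subM sP); first exact: subV.
  by apply: (subM sP) => //; exact: Nx.
exists N; split=> //.
  by move=> g x /NE Nx; apply/NE => h; rewrite -conjgM; exact: Nx.
by move=> x /NE/(_ 1); rewrite conjg1.
Qed.

(** If k is in the closure, then it is in every finite index P that contains H,
since the coset of the normal core of P at k is a neighbourhood of k and meets
H. *)
Lemma pclosure_closed H : pclosure H `<=` H -> profinitely_closed H.
Proof.
move=> HH k kH; apply: HH => P sP fP HP.
have [N [sN nN fN NP]] := normal_core sP fP.
have [h [Hh [x Nx xh]]] : (H : set (profinite G)) `&` lcoset k N !=set0.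
  apply: kH; apply: open_nbhs_nbhs; split; last by exists 1; [exact: sub1 | rewrite mulg1].
  exists [set lcoset k N]; last by rewrite bigcup_set1.
  by move=> _ ->; exists N, k.
have -> : k = h * x^-1 by rewrite -xh mulgK.
by apply: (subM sP); [exact: HP | apply: (subV sP); exact: NP].
Qed.

End ProfiniteClosure.

(** * Separability of quasiconvex subgroups *)

Section Separability.
Variables (G : groupType) (A : set G) (D : nat).
Hypothesis finite_gen : finite_symmetrized_generating_set A.
Hypothesis hl : hyperbolic_length (word_length A) D.
Hypothesis tf : torsion_free G.
Hypothesis engulfing : forall H : set G,
  is_subgroup H -> H <> setT -> quasiconvex A H -> engulfed H.
Implicit Types (H K M : set G) (f g h k x y : G).
Local Notation near_geodesics := (near_geodesics (word_length A)).
Local Notation nontrivial H := (exists2 h, H h & h <> 1).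

(** The letters with index below [ord_max] bring the generators of G into the
engulfing subgroup; the last one, whose element a is the default value 1 of
[nth], is left out to make the engulfed subgroup proper. *)
Lemma closure_covered e M : is_subgroup M -> near_geodesics e M ->
  nontrivial M -> covered M (pclosure M).
Proof.
move=> sM qM Mn; apply: contrapT => ncov.
have [/finite_seqP[S AS] _ gen] := finite_gen.
pose a (j : 'I_(size S).+1) := nth 1 S j.
have sK := pclosure_subgroup M.
have [c [s [fs sa]]] := free_over_exists hl tf a sM sK (@sub_pclosure _ M) qM Mn ncov.
pose J : set ('I_(size S).+1 * bool) := [set i | i.1 <> ord_max].
have JV i : J i -> J (mate i) by [].
pose Q := free_join s M J.
have sQ : is_subgroup Q by exact: (free_join_subgroup fs sM JV).
have QT : Q <> setT.
  move=> QT; have : Q (s (ord_max, false)) by rewrite QT.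
  apply: (@free_join_proper _ _ _ hl _ _ _ _ sM fs M J (ord_max, false)) => //.
have qQ : quasiconvex A Q.
  by apply/quasiconvexP => //; apply: (free_join_near_geodesics hl sM fs sM _ JV qM).
have [P [sP PT fP QP]] := engulfing sQ QT qQ.
have MP : M `<=` P by move=> m Mm; apply: QP; exact: free_join_base.
have KP := pclosure_min sP fP MP.
apply: PT; apply/seteqP; split=> // g _; have [w [Aw <-]] := gen g.
elim: w Aw => [|b w IHw] Aw; first by rewrite gprod0; exact: sub1.
rewrite gprod_cons; apply: (subM sP); last first.
  by apply: IHw => d dw; apply: Aw; rewrite inE dw orbT.
have bS : b \in S by have := Aw b (mem_head _ _); rewrite AS.
have bN : (index b S < (size S).+1)%N by rewrite ltnS index_size.
have [k1 [k2 [Kk1 Kk2 sE]]] := sa (Ordinal bN).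
have Ps : P (s (Ordinal bN, false)).
  apply: QP; apply: (free_join_gen fs sM) => //= e'.
  by have := congr1 val e'; rewrite /= => /eqP; rewrite ltn_eqF // index_mem.
have -> : b = k1^-1 * s (Ordinal bN, false) * k2^-1.
  by rewrite sE /a /= nth_index // !gcancel.
apply: (subM sP); last by apply: (subV sP); exact: KP.
by apply: (subM sP) => //; apply: (subV sP); exact: KP.
Qed.

Lemma near_geodesics_covered e H K : is_subgroup H -> H `<=` K ->
  near_geodesics e H -> covered H K -> exists e', near_geodesics e' K.
Proof.
move=> sH HK qH [F FP].
have [B BP] : exists B, forall f, f \in F -> (word_length A f <= B)%N.
  exists (\sum_(f <- F) word_length A f)%N => f fF.
  by rewrite (big_rem f) //= leq_addr.
exists (e + 2 * B + D)%N => k x Kk; rewrite /between !gcancel => bx.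
have [f fF Hkf] := FP k Kk.
have [|h Hh xh] := near_quasigeodesic hl (e := 2 * B) (x := x) qH Hkf.
  rewrite /between !gcancel; have := BP f fF.
  have := lenM hl (x^-1 * k) f^-1; have := len_mul_ge hl k f^-1.
  by rewrite !(lenV hl); glia.
by exists h => //; exact: HK.
Qed.

Lemma pclosure_nontrivial e H : is_subgroup H -> near_geodesics e H ->
  nontrivial H -> pclosure H `<=` H.
Proof.
move=> sH qH Hn k Kk; apply: contrapT => nHk.
have sK := pclosure_subgroup H; have HK := @sub_pclosure _ H.
have HcK := closure_covered sH qH Hn.
have [e' qK] := near_geodesics_covered sH HK qH HcK.
have sT : is_subgroup [set: G] by apply/is_subgroupP.
have [h0 Hh0 h01] := Hn.
have Kn : nontrivial (pclosure H) by exists h0 => //; exact: HK.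
(* Otherwise H has finite index in G and is its own closure. *)
have ncov : ~ covered (pclosure H) setT.
  move=> cov; apply: nHk; apply: Kk => //; apply: covered_finite_index => //.
  exact: covered_trans cov.
have [c [s [fs _]]] := @free_over_exists _ _ _ hl tf e' (pclosure H) setT 1
  (fun=> 1) sK sT (fun _ _ => I) qK Kn ncov.
pose i : 'I_1 * bool := (ord0, false).
pose J : set ('I_1 * bool) := setT.
pose M := free_join s H J.
have sM : is_subgroup M by exact: (free_join_subgroup fs sH).
have [e'' qM] : exists e'', near_geodesics e'' M.
  by apply: (free_join_near_geodesics hl sK fs sH HK _ qH).
have HM : H `<=` M by move=> h Hh; exact: free_join_base.
have Mn : nontrivial M by exists h0 => //; exact: HM.
have [F FP] := closure_covered sM qM Mn.
have ks n : pclosure M ((k * s i) ^+ n).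
  apply: (subX (pclosure_subgroup M)).
  apply: (subM (pclosure_subgroup M)); first exact: pclosure_mono Kk.
  by apply: sub_pclosure; exact: (free_join_gen fs sH).
have nF n : exists f, f \in F /\ M ((k * s i) ^+ n * f^-1).
  by have [f fF Mf] := FP _ (ks n); exists f.
have [fn fnP] := choice nF.
have [|n [m [nm _ fnm]]] := @finite_repetition _ F fn.
  by move=> n _; exact: (fnP n).1.
apply: (@free_join_power _ _ _ hl _ _ _ _ sK fs H J i k (m - n)%N) => //.
  by rewrite subn_gt0.
rewrite expgnFr 1?ltnW //; have Mn' := (fnP n).2; have := (fnP m).2.
rewrite -fnm => Mm; have := subM sM Mm (subV sM Mn').
by rewrite !gcancel.
Qed.

Lemma pclosure1 : pclosure [set 1 : G] `<=` [set 1].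
Proof.
move=> k K1k; apply: contrapT => /= k1.
have sT : is_subgroup [set: G] by apply/is_subgroupP.
have s1 : is_subgroup [set 1 : G].
  by apply/is_subgroupP; split=> // x y /= -> ->; rewrite !gcancel.
have qT : near_geodesics 0 setT.
  by move=> h x _ _; exists x => //; rewrite mulVg (len1 hl).
have q1 : near_geodesics 0 [set 1 : G].
  move=> _ x ->; rewrite /between !gcancel (len1 hl) (lenV hl) => x0.
  by exists 1 => //; rewrite mulg1 (lenV hl); lia.
have [f [c [_ f1 lf]]] := loxodromic_exists hl tf sT qT (ex_intro2 _ _ k I k1).
have [n n0 fn] := unbounded_powers hl tf (word_length A k + 4 * c + 8 * D + 1) f1.
pose s (i : 'I_1 * bool) := if i.2 then (f ^+ n)^-1 else f ^+ n.
have ls i : word_length A (s i) = word_length A (f ^+ n).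
  by rewrite /s; case: i.2; rewrite ?(lenV hl).
(* The cyclic subgroup generated by f ^+ n is a free join over the trivial
   subgroup, and its nontrivial elements are longer than k. *)
have fs : free_over (word_length A) D [set 1] c s.
  split.
  - by move=> [i []]; rewrite /s /= ?invgK.
  - by move=> _ i ->; rewrite /diverge (len1 hl) !gcancel; lia.
  - move=> _ [i a] [j b] ->; rewrite mul1g (ord1 i) (ord1 j) /s => ij.
    have := lf n n; rewrite expgVn_mulV => ff.
    by case: a b ij => [] [] ij //=; [case: ij | exact: (diverge_sym hl) | case: ij].
  - by move=> i; rewrite ls; lia.
have sM : is_subgroup (free_join s [set 1] setT) by exact: (free_join_subgroup fs s1).
have [e qM] : exists e, near_geodesics e (free_join s [set 1] setT).
  exact: (free_join_near_geodesics hl s1 fs s1 _ _ q1).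
have Mn : nontrivial (free_join s [set 1] setT).
  exists (f ^+ n); last exact: expg_neq1.
  exact: (free_join_gen fs s1 (i := (ord0, false))).
have Mk : free_join s [set 1] setT k.
  apply: (pclosure_nontrivial sM qM Mn).
  by apply: pclosure_mono K1k => _ ->; exact: free_join_base.
have [i] := free_join_long hl s1 fs (fun _ => id) Mk k1.
by rewrite ls; lia.
Qed.

End Separability.

Theorem corollary1 (G : groupType) (A : set G)
  (finite_gen : finite_symmetrized_generating_set A)
  (hyperbolic : gromov_hyperbolic A)
  (torsionfree : torsion_free G)
  (engulfing : forall H : set G,
     is_subgroup H -> H <> setT -> quasiconvex A H -> engulfed H) :
  GFERF A.
Proof.
have [D hl] := word_length_hyperbolic finite_gen hyperbolic.
move=> H sH /(quasiconvexP finite_gen sH)[e qH]; apply: pclosure_closed.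
have [Hn|H1] := pselect (exists2 h, H h & h <> 1).
  exact: (pclosure_nontrivial finite_gen hl torsionfree engulfing sH qH Hn).
have -> : H = [set 1].
  apply/seteqP; split=> [h Hh|_ ->]; last exact: sub1.
  by apply: contrapT => h1; apply: H1; exists h.
exact: (pclosure1 finite_gen hl torsionfree engulfing).
Qed.
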